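(* Let $(G,\mu)$ be a $C$-twisted topological group. Then the Grothendieck group $K_0^{\mathrm{fin}}(G,\mu,C)$ of $C$-admissible representations of $(G,\mu)$ with finite projective image is generated by the classes of those $C$-admissible representations (with finite projective image) of the form $\mathrm{Ind}_H^G V$, where $H$ is an open subgroup of finite index in $G$ and $V$ is a one-dimensional $C$-admissible representation of $(H,\mu|_H)$.
   Context: $\ell$ is a prime and $C$ is an algebraic closure of $\mathbb{Q}_\ell$ with the topology induced by the $\ell$-adic valuation. A map from a topological space to $C$ is $C$-admissible if it is continuous with image in a finite extension of $\mathbb{Q}_\ell$ in $C$. For a finite dimensional $C$-vector space $V$, a map $f$ from a topological space to $\mathrm{Aut}_C(V)$ is $C$-admissible if there are a finite extension $E$ of $\mathbb{Q}_\ell$ in $C$ and an $E$-form $V_0$ of $V$ such that $f$ factors through a continuous map to $\mathrm{Aut}_E(V_0)$. A $C$-admissible multiplier on a topological group $G$ is a $C$-admissible map $\mu:G\times G\to C^\times$ with $\mu(1,1)=1$ and $\mu(x,y)\mu(xy,z)=\mu(x,yz)\mu(y,z)$ for all $x,y,z$. A $C$-twisted topological group is a pair $(G,\mu)$ of this kind. A $C$-admissible representation of $(G,\mu)$ is a pair $(V,\rho)$ with $V$ a finite dimensional $C$-vector space and $\rho:G\to\mathrm{Aut}_C(V)$ a $C$-admissible map with $\rho(x)\rho(y)=\mu(x,y)\rho(xy)$; morphisms are $C$-linear maps commuting with the $\rho$'s. It has finite projective image if the composition $G\to\mathrm{Aut}_C(V)/C^\times$ has finite image. $K_0^{\mathrm{fin}}(G,\mu,C)$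 is the abelian group generated by classes $[V]$ of $C$-admissible representations with finite projective image, with relations $[V]=[V']+[V'']$ for each extension $V$ of $V'$ by $V''$ of such representations. For $H\subseteq G$ open of finite index and $V$ a $C$-admissible representation of $(H,\mu|_H)$, $\mathrm{Ind}_H^GV=C[G,\mu]\otimes_{C[H,\mu|_H]}V$, where $C[G,\mu]$ is the $C$-algebra with basis $([x])_{x\in G}$ and product $[x][y]=\mu(x,y)[xy]$; it is a $C$-admissible representation of $(G,\mu)$, $x\in G$ acting by left multiplication by $[x]$. *)

(* Defs.v *)
From HB Require Import structures.
From mathcomp Require Import all_boot all_order all_algebra.
From mathcomp Require Import all_classical ereal topology.
From mathcomp Require Import freeg.

Set Implicit Arguments.
Unset Strict Implicit.
Unset Printing Implicit Defensive.

Import Order.TTheory GRing.Theory Num.Theory.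
Local Open Scope classical_set_scope.
Local Open Scope ring_scope.
Local Open Scope quotient_scope.

Definition valuation (F : fieldType) (v : F -> \bar rat) : Prop :=
  [/\ forall x, v x = +oo%E <-> x = 0,
      forall x, v x <> -oo%E,
      forall x y, v (x * y) = (v x + v y)%E
    & forall x y, (mine (v x) (v y) <= v (x + y)%R)%E].

Definition val_ge (F : fieldType) (v : F -> \bar rat) (n : nat) (x : F) : bool :=
  (n%:R%:E <= v x)%E.

(* (K, vK) is a completion of the field of rational numbers for the l-adic
   valuation, that is, a copy of the field of l-adic numbers, with v(l) = 1.
   The second condition forces K to have characteristic zero, so that ratr is
   the embedding of the rational numbers in K. *)
Definition is_Ql (l : nat) (K : fieldType) (vK : K -> \bar rat) : Prop :=
  [/\ valuation vK,
      forall n : nat, (0 < n)%N -> vK n%:R = (logn l n)%:R%:E,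
      forall (x : K) (n : nat), exists q : rat, val_ge vK n (x - ratr q)
    & forall u : nat -> K,
        (forall n : nat, exists N : nat, forall i j : nat,
           (N <= i)%N -> (N <= j)%N -> val_ge vK n (u i - u j)) ->
        exists x : K, forall n : nat, exists N : nat, forall i : nat,
           (N <= i)%N -> val_ge vK n (u i - x)].

#[short(type="topClosedFieldType")]
HB.structure Definition TopologicalClosedField :=
  {C of GRing.ClosedField C & Topological C}.

(* C is an algebraic closure, via iota, of a field K of l-adic numbers, with
   the topology given by an extension v to C of the l-adic valuation of K
   (it is unique because K is complete, and has rational values). *)
Definition is_Ql_closure (l : nat) (K : fieldType) (C : topClosedFieldType)
    (iota : {rmorphism K -> C}) : Prop :=
  exists (vK : K -> \bar rat) (v : C -> \bar rat),
  [/\ is_Ql l vK,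
      forall x : C, algebraicOver iota x,
      valuation v,
      forall a : K, v (iota a) = vK a
    & forall (x : C) (A : set C),
        nbhs x A <-> exists n : nat, forall y, val_ge v n (y - x) -> A y].

HB.mixin Record isTopologicalGroup G of monoid.Group G & Topological G := {
  mulg_continuous : continuous (fun p : G * G => (p.1 * p.2)%g);
  invg_continuous : continuous (fun x : G => x^-1)%g
}.

#[short(type="topGroupType")]
HB.structure Definition TopologicalGroup :=
  {G of monoid.Group G & Topological G & isTopologicalGroup G}.

Section SubgroupTopology.
Variables (G : topGroupType) (H : groupClosed G).

Definition subgroup : Type := set_type [set` H].

HB.instance Definition _ := SubChoice.on subgroup.
HB.instance Definition _ := Topological.on subgroup.

Fact subgroup_closed : group_closed (mem [set` H]).
Proof.
split; first by rewrite inE /= gpred1.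
by move=> x y; rewrite !inE /= => xH yH; rewrite gpredF.
Qed.

HB.instance Definition _ :=
  SubChoice_isSubGroup.Build G (mem [set` H]) subgroup subgroup_closed.

Let val_continuous : continuous (val : subgroup -> G).
Proof. exact: (@initial_continuous subgroup G set_val). Qed.

Let continuous_to_subgroup (T : topologicalType) (f : T -> subgroup) :
  continuous (val \o f) -> continuous f.
Proof. exact: (@continuous_comp_initial subgroup T G set_val f). Qed.

Fact subgroup_mul_continuous :
  continuous (fun p : subgroup * subgroup => (p.1 * p.2)%g).
Proof.
apply: continuous_to_subgroup => -[x y] /=.
have -> : val \o (fun p : subgroup * subgroup => (p.1 * p.2)%g) =
          (fun p => (p.1 * p.2)%g) \o
            (fun p : subgroup * subgroup => (val p.1, val p.2)).
  by apply/funext.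
apply: continuous_comp; last exact: mulg_continuous.
apply: cvg_pair => /=.
  by apply: (cvg_comp fst val); [exact: cvg_fst | exact: val_continuous].
by apply: (cvg_comp snd val); [exact: cvg_snd | exact: val_continuous].
Qed.

Fact subgroup_inv_continuous : continuous (fun x : subgroup => x^-1)%g.
Proof.
apply: continuous_to_subgroup => x /=.
apply: (cvg_comp (val : subgroup -> G) (fun y : G => y^-1)%g).
  exact: val_continuous.
exact: invg_continuous.
Qed.

HB.instance Definition _ := isTopologicalGroup.Build subgroup
  subgroup_mul_continuous subgroup_inv_continuous.

End SubgroupTopology.

Section SubgroupGenerated.
Variables (M : zmodType) (S : set M).

(* The subgroup of M generated by S. *)
Definition gen : {pred M} := fun x =>
  `[< forall N : zmodClosed M, (forall y, S y -> y \in N) -> x \in N >].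

Fact gen_zmod_closed : zmod_closed gen.
Proof.
split; first by apply/asboolP => N _; exact: rpred0.
move=> x y /asboolP xN /asboolP yN; apply/asboolP => N SN.
by rewrite rpredB ?xN ?yN.
Qed.

HB.instance Definition _ := GRing.isZmodClosed.Build M gen gen_zmod_closed.

End SubgroupGenerated.

Section AdmissibleMaps.
Variables (K : fieldType) (C : topClosedFieldType) (iota : {rmorphism K -> C}).

Definition finite_extension (E : {pred C}) : Prop :=
  [/\ divring_closed E, forall a : K, iota a \in E
    & exists s : seq C, forall x, x \in E ->
        exists c : 'I_(size s) -> K, x = \sum_i iota (c i) * s`_i].

Definition admissible (T : topologicalType) (f : T -> C) : Prop :=
  continuous f /\
  exists E : {pred C}, finite_extension E /\ forall t, f t \in E.

(* The E-forms of V are the E-spans of the C-bases b of V. *)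
Definition E_form (E : {pred C}) (V : vectType C)
    (b : (\dim {:V}).-tuple V) : set V :=
  [set u | forall i, coord b i u \in E].

(* Each f t restricts to an automorphism of the E-form V_0. Aut_E(V_0) has the
   topology of GL_n(E), so that continuity is continuity of the matrix entries
   in the E-basis b of V_0; E has the topology induced by C. *)
Definition admissible_aut (T : topologicalType) (V : vectType C)
    (f : T -> 'End(V)) : Prop :=
  (forall t, lker (f t) == 0%VS) /\
  exists (E : {pred C}) (b : (\dim {:V}).-tuple V),
  [/\ finite_extension E, basis_of {:V} b,
      forall t, f t @` E_form E b = E_form E b
    & forall i j, continuous (fun t => coord b i (f t b`_j))].

End AdmissibleMaps.

Section Representations.
Variables (K : fieldType) (C : topClosedFieldType) (iota : {rmorphism K -> C}).

Definition admissible_multiplier (G : topGroupType) (mu : G -> G -> C) : Prop :=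
  [/\ admissible iota (fun p : G * G => mu p.1 p.2),
      forall x y, mu x y != 0,
      mu 1%g 1%g = 1
    & forall x y z, mu x y * mu (x * y)%g z = mu x (y * z)%g * mu y z].

Definition restrict_mul (G : topGroupType) (mu : G -> G -> C)
    (H : groupClosed G) : subgroup H -> subgroup H -> C :=
  fun x y => mu (val x) (val y).

Record adm_rep (G : topGroupType) (mu : G -> G -> C) := AdmRep {
  rep_space :> vectType C;
  rep_act : G -> 'End(rep_space);
  rep_admissible : admissible_aut iota rep_act;
  rep_mul : forall x y,
    (rep_act x \o rep_act y)%VF = mu x y *: rep_act (x * y)%g
}.

(* The class of f in the quotient of Aut_C(V) by the scalars. *)
Definition proj_class (V : vectType C) (f : 'End(V)) : set 'End(V) :=
  [set g | exists2 c : C, c != 0 & g = c *: f].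

Definition finite_projective_image (G : topGroupType) (mu : G -> G -> C)
    (V : adm_rep mu) : Prop :=
  finite_set (range (fun x => proj_class (rep_act V x))).

(* Representations on the coordinate spaces C^n: they represent all isomorphism
   classes of representations with finite projective image and, unlike those
   on arbitrary spaces, they form a type small enough to be a choiceType. *)
Record fin_rep (G : topGroupType) (mu : G -> G -> C) := FinRep {
  fin_rep_dim : nat;
  fin_rep_act : G -> 'End('rV[C]_fin_rep_dim);
  fin_rep_admissible : admissible_aut iota fin_rep_act;
  fin_rep_mul : forall x y,
    (fin_rep_act x \o fin_rep_act y)%VF = mu x y *: fin_rep_act (x * y)%g;
  fin_rep_finite :
    finite_projective_image (AdmRep fin_rep_admissible fin_rep_mul)
}.

Coercion fin_rep_rep (G : topGroupType) (mu : G -> G -> C) (V : fin_rep mu) :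
  adm_rep mu := AdmRep (fin_rep_admissible V) (@fin_rep_mul G mu V).

HB.instance Definition _ (G : topGroupType) (mu : G -> G -> C) :=
  gen_eqMixin (fin_rep mu).
HB.instance Definition _ (G : topGroupType) (mu : G -> G -> C) :=
  gen_choiceMixin (fin_rep mu).

Definition rep_hom (G : topGroupType) (mu : G -> G -> C) (V W : adm_rep mu)
    (f : 'Hom(V, W)) : Prop :=
  forall x, (f \o rep_act V x)%VF = (rep_act W x \o f)%VF.

Definition extension (G : topGroupType) (mu : G -> G -> C)
    (V' V V'' : adm_rep mu) : Prop :=
  exists (f : 'Hom(V', V)) (g : 'Hom(V, V'')),
  [/\ rep_hom f, rep_hom g, lker f == 0%VS, limg f = lker g
    & limg g = fullv].

Section GrothendieckGroup.
Variables (G : topGroupType) (mu : G -> G -> C).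

Definition K0fin_rel : set {freeg (fin_rep mu)} :=
  [set r | exists V' V V'' : fin_rep mu,
     extension V' V V'' /\ r = << V : fin_rep mu >>
       - (<< V' : fin_rep mu >> + << V'' : fin_rep mu >>)].

Definition K0fin : zmodType := Quotient.quot (gen K0fin_rel).

Definition K0class (V : fin_rep mu) : K0fin :=
  \pi_(Quotient.quot (gen K0fin_rel)) << V : fin_rep mu >>.

End GrothendieckGroup.

(* C[G, mu] is the free C-module {freeg G / C} on G with this product. *)
Definition twalg_mul (G : topGroupType) (mu : G -> G -> C)
    (a b : {freeg G / C}) : {freeg G / C} :=
  fglift (fun x => fglift (fun y => mu x y *: << (x * y)%g >>) b) a.

Definition twalg_act (G : topGroupType) (mu : G -> G -> C) (V : adm_rep mu)
    (a : {freeg G / C}) (v : V) : V :=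
  fglift (fun x => rep_act V x v) a.

Section Induction.
Variables (G : topGroupType) (mu : G -> G -> C) (H : groupClosed G).
Variable V : adm_rep (@restrict_mul G mu H).

Definition twalg_incl (b : {freeg (subgroup H) / C}) : {freeg G / C} :=
  fglift (fun h => << val h >>) b.

Definition tensor_rel : set {freeg ({freeg G / C} * V)%type} :=
  [set r | exists (a a' : {freeg G / C}) (v : V),
     r = << (a + a', v) >> - (<< (a, v) >> + << (a', v) >>)] `|`
  [set r | exists (a : {freeg G / C}) (v v' : V),
     r = << (a, v + v') >> - (<< (a, v) >> + << (a, v') >>)] `|`
  [set r | exists (a : {freeg G / C}) (b : {freeg (subgroup H) / C}) (v : V),
     r = << (twalg_mul mu a (twalg_incl b), v) >> - << (a, twalg_act b v) >>].

(* The tensor product of C[G, mu] and V over C[H, mu|_H]. *)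
Definition Ind : zmodType := Quotient.quot (gen tensor_rel).

Definition tensor (a : {freeg G / C}) (v : V) : Ind :=
  \pi_(Quotient.quot (gen tensor_rel)) << (a, v) >>.

(* W is isomorphic to Ind as a left C[G, mu]-module: since the tensors
   generate Ind, the second condition is C[G, mu]-linearity of phi. *)
Definition is_Ind (W : adm_rep mu) : Prop :=
  exists phi : {additive Ind -> W},
    bijective phi /\
    forall a b v, phi (tensor (twalg_mul mu a b) v) =
                  twalg_act a (phi (tensor b v)).

End Induction.

Definition finite_index (G : topGroupType) (H : groupClosed G) : Prop :=
  finite_set (range (fun x : G => [set y : G | (x^-1 * y)%g \in H])).

Definition induced_from_dim1 (G : topGroupType) (mu : G -> G -> C)
    (W : adm_rep mu) : Prop :=
  exists (H : groupClosed G) (V : adm_rep (@restrict_mul G mu H)),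
  [/\ open [set` H], finite_index H, \dim {:V} = 1%N & is_Ind V W].

End Representations.

(* Main.v *)
Require Import Defs.
From HB Require Import structures.
From mathcomp Require Import all_boot all_order all_algebra.
From mathcomp Require Import all_fingroup all_solvable all_field all_character.
From mathcomp Require Import boolp mxtens ring lra zify.

(** Let V be a representation of (G, mu) with finite projective image, given by
    matrices R x. Its projective image is a finite group Q; choosing a preimage
    of each element of Q turns R into a projective representation M of Q, and
    R x is proportional to M (p x), where p : G -> Q is the projection
    ([projective_image]). Proportionality to a given matrix is a closed
    condition and there are finitely many classes, so p is locally constant
    ([proportional_open]).

    The proof is Brauer's induction argument, applied to the trivial character
    of Q only, so that it never meets the characters of (G, mu). By Solomon's
    theorem ([solomon_induction]) there are finite Q-sets X and Y such that
    every g in Q has exactly one more fixed point in X than in Y, and whose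
    point stabilisers are all contained in hyperelementary subgroups, that is,
    extensions of a p-group by a normal cyclic group. In characteristic zero
    traces determine representations ([mx_rsim_mxtrace]), so C[X] is isomorphic
    to the sum of C[Y] and the trivial representation. Tensoring with V, where
    G acts on C[X] and C[Y] through p, gives
    [V] = [C[X] (x) V] - [C[Y] (x) V] in the Grothendieck group.

    It remains to see that C[X] (x) V is a sum of representations induced from
    dimension one. A projective representation of a hyperelementary group
    permutes the lines of some basis ([frame_hyperelementary]): the eigenspaces
    of a generator of the cyclic group are permuted, so only the stabiliser of
    an eigenspace matters, and there the cyclic group acts by scalars; then one
    uses the eigenspaces of an element that is central modulo scalars, which
    exists because p-groups have nontrivial centres. Carrying such lines along
    the orbits of X gives lines of C[X] (x) V permuted by Q
    ([frame_tens_perm]). Thus C[X] (x) V is monomial. It splits along the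
    orbits of G on the lines ([matrix_class_split]), and a summand with one
    orbit is induced from the stabiliser of a line, an open subgroup of finite
    index ([induced_from_line]).

    The topology is controlled by one fact: the C-admissible functions on a
    topological space form an algebra that contains the constants. It rests
    on the compositum of two finite extensions being finite
    ([finite_extension_compositum]) and makes admissibility of a representation
    a property of its matrix entries, whatever the basis. *)

Set Implicit Arguments.
Unset Strict Implicit.
Unset Printing Implicit Defensive.

Import Order.TTheory GRing.Theory Num.Theory.

Local Open Scope group_scope.

(** * Solomon's induction theorem *)

Definition hyperelementary (gT : finGroupType) (H : {group gT}) : Prop :=
  exists (p : nat) (d : gT),
    [/\ prime p, <[d]> <| H & p.-group (H / <[d]>)].

(** Take H between C, the cyclic group generated by the p'-part y of x, and its
    normaliser N, with H / C a Sylow p-subgroup of N / C. A coset H g fixed by x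
    satisfies y ^ g^-1 \in H; being a p'-element this lies in C, which forces
    g \in N. On the cosets contained in N, y acts trivially, so that x acts
    through its p-part and the number of fixed points is congruent to #|N : H|
    modulo p. *)
Lemma hyperelementary_fix (gT : finGroupType) (p : nat) (x : gT) : prime p ->
  exists H : {group gT}, hyperelementary H /\
    ~~ (p %| #|[set A in rcosets H setT | A :* x == A]|).
Proof.
move=> pr_p; pose y := x.`_p^'; pose C := <[y]>; pose N := 'N(C)%G.
have nCN : C <| N by rewrite /normal normG subxx.
have [P sylP] := Sylow_exists p (N / C)%G.
have [H defP sCH sHN] := inv_quotientS nCN (pHall_sub sylP).
have nCH : C <| H by rewrite /normal sCH sHN.
have pH : p.-group (H / C) by rewrite -defP; exact: pHall_pgroup sylP.
exists H; split; first by exists p, y.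
have yC z : z \in H -> p^'.-elt z -> z \in C.
  move=> Hz p'z; have Nz : z \in 'N(C) by apply: (subsetP sHN).
  apply: coset_idr => //; apply/eqP; rewrite -order_eq1.
  apply/eqP/(@pnat_1 p); last exact: morph_p_elt.
  by apply: mem_p_elt pH _; apply: mem_quotient.
have fixE g z : (H :* g :* z == H :* g) = (z ^ g^-1 \in H).
  by rewrite -rcosetM conjgCV (sameP eqP rcoset_eqP) mem_rcoset mulgK.
have fixN A : A \in rcosets H N -> A :* y = A.
  case/rcosetsP=> g Ng ->; apply/eqP; rewrite fixE; apply: (subsetP sCH).
  by rewrite memJ_norm ?groupV // cycle_id.
have -> : [set A in rcosets H setT | A :* x == A] =
          'Fix_(rcosets H N | 'Rs)(<[x.`_p]>).
  apply/setP=> A; rewrite afix_cycle inE [RHS]inE.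
  apply/andP/andP => [[]|[RA]].
    case/rcosetsP=> g _ -> fx; have := fx; rewrite fixE => Hx.
    have Hy : y ^ g^-1 \in H by rewrite /y -consttJ groupX.
    have Cy : y ^ g^-1 \in C by apply: yC => //; rewrite p_eltJ p_elt_constt.
    have Ng : g \in N by rewrite -groupV inE -cycleJ cycle_subG.
    have RA : H :* g \in rcosets H N by apply/rcosetsP; exists g.
    split=> //; apply/afix1P => /=.
    by rewrite rcosetE; apply/eqP; rewrite fixE -consttJ groupX.
  move/afix1P => /=; rewrite rcosetE => fxp; split;
    first by case/rcosetsP: RA => g _ ->; apply/rcosetsP; exists g.
  by rewrite -(consttC p x) rcosetM fxp fixN.
have actP : [acts <[x.`_p]>, on rcosets H N | 'Rs].
  apply: subset_trans (actsRs_rcosets H N); rewrite cycle_subG.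
  apply: (subsetP (cent_sub _)); rewrite cent_cycle; apply/cent1P.
  exact: commuteX2.
have /eqP eqm := pgroup_fix_mod (p_elt_constt p x : p.-group <[_]>) actP.
rewrite /dvdn -(eqP eqm) -/(dvdn _ _) -/(indexg N H).
have [_ _] := and3P sylP; rewrite defP index_quotient_eq ?subIset ?sCH ?orbT //.
by rewrite p'natE.
Qed.

Section PermutationCharacters.
Variables (gT : finGroupType) (F : {set gT} -> Prop).
Hypothesis subF : forall A B : {set gT}, B \subset A -> F A -> F B.
Hypothesis hyperF : forall H : {group gT}, hyperelementary H -> F H.
Local Open Scope ring_scope.

Definition fixed_points (X : finType) (to : {action gT &-> X}) (g : gT) :=
  [set x | to x g == x].

Definition stabilizers_in (X : finType) (to : {action gT &-> X}) :=
  forall x, F [set g | to x g == x].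

Definition perm_char (f : gT -> int) :=
  exists (X : finType) (to : {action gT &-> X}),
    stabilizers_in to /\ forall g, f g = #|fixed_points to g|%:Z.

(** The differences of two permutation characters form a ring without unit,
    the stabilisers in a product being intersections of stabilisers; Solomon's
    theorem says that it contains 1. *)
Definition virtual_perm_char (f : gT -> int) :=
  exists f1 f2, [/\ perm_char f1, perm_char f2 & forall g, f g = f1 g - f2 g].

Lemma perm_charD f1 f2 :
  perm_char f1 -> perm_char f2 -> perm_char (fun g => f1 g + f2 g).
Proof.
move=> [X [a [Fa fa]]] [Y [b [Fb fb]]].
pose to (z : X + Y) g :=
  match z with inl x => inl (a x g) | inr y => inr (b y g) end.
have to1 : to^~ 1%g =1 id by case=> z; rewrite /to act1.
have toM z : act_morph to z by move=> g h; case: z => z; rewrite /to actM.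
exists (X + Y)%type, (TotalAction to1 toM); split=> [[x|y]|g].
- by apply: subF (Fa x); apply/subsetP => g; rewrite !inE.
- by apply: subF (Fb y); apply/subsetP => g; rewrite !inE.
rewrite fa fb -PoszD; congr Posz; rewrite !cardsE -!sum1_card big_sumType /=.
by congr (_ + _)%N; apply: eq_bigl => z; rewrite !inE.
Qed.

Lemma perm_charM f1 f2 :
  perm_char f1 -> perm_char f2 -> perm_char (fun g => f1 g * f2 g).
Proof.
move=> [X [a [Fa fa]]] [Y [b [Fb fb]]].
pose to (z : X * Y) g := (a z.1 g, b z.2 g).
have to1 : to^~ 1%g =1 id by case=> x y; rewrite /to !act1.
have toM z : act_morph to z by move=> g h; rewrite /to !actM.
exists (X * Y)%type, (TotalAction to1 toM); split=> [[x y]|g].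
  by apply: subF (Fa x); apply/subsetP => g; rewrite !inE xpair_eqE => /andP[].
rewrite fa fb -PoszM; congr Posz; rewrite -cardsX; apply: eq_card => -[x y].
by rewrite !inE.
Qed.

Lemma virtual_perm_charN f : virtual_perm_char f ->
  virtual_perm_char (fun g => - f g).
Proof.
by move=> [f1 [f2 [p1 p2 e]]]; exists f2, f1; split=> // g; rewrite e opprB.
Qed.

Lemma virtual_perm_charD f1 f2 : virtual_perm_char f1 -> virtual_perm_char f2 ->
  virtual_perm_char (fun g => f1 g + f2 g).
Proof.
move=> [a1 [b1 [pa1 pb1 e1]]] [a2 [b2 [pa2 pb2 e2]]].
exists (fun g => a1 g + a2 g), (fun g => b1 g + b2 g).
split; [exact: perm_charD.. |] => g; rewrite e1 e2; ring.
Qed.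

Lemma virtual_perm_charM f1 f2 : virtual_perm_char f1 -> virtual_perm_char f2 ->
  virtual_perm_char (fun g => f1 g * f2 g).
Proof.
move=> [a1 [b1 [pa1 pb1 e1]]] [a2 [b2 [pa2 pb2 e2]]].
exists (fun g => a1 g * a2 g + b1 g * b2 g), (fun g =>
  a1 g * b2 g + b1 g * a2 g).
split; [by do ?[apply: perm_charD | apply: perm_charM]..|] => g;
  rewrite e1 e2; ring.
Qed.

Lemma perm_char_rcosets (H : {group gT}) : (forall h, F (H :^ h)%g) ->
  perm_char (fun x => #|[set A in rcosets H setT | A :* x == A]|%:Z).
Proof.
move=> FH; pose X := {A : {set gT} | A \in rcosets H setT}.
have stX (A : X) g : val A :* g \in rcosets H setT.
  case: A => A /= /rcosetsP[h _ ->]; rewrite -rcosetM.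
  by apply/rcosetsP; exists (h * g)%g.
pose to (A : X) g : X := exist _ (val A :* g) (stX A g).
have to1 : to^~ 1%g =1 id by move=> A; apply: val_inj; rewrite /= mulg1.
have toM A : act_morph to A by move=> g h; apply: val_inj; rewrite /= rcosetM.
exists X, (TotalAction to1 toM); split=> [[A RA]|g].
  have [h _ eA] := rcosetsP RA; apply: subF (FH h); apply/subsetP => g.
  rewrite inE -val_eqE /= {1 2}eA -rcosetM conjgCV.
  by rewrite (sameP eqP rcoset_eqP) mem_rcoset mulgK mem_conjg.
congr Posz; rewrite -[RHS](card_imset _ val_inj); apply: eq_card => A.
rewrite inE; apply/andP/imsetP => [[RA fA]|[B + ->]].
  by exists (exist _ A RA : X) => //; rewrite inE -val_eqE.
by rewrite inE -val_eqE /= => ->; split=> //; case: B.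
Qed.

Lemma hyperelementaryJ (H : {group gT}) h :
  hyperelementary H -> hyperelementary (H :^ h)%G.
Proof.
move=> [p [d [pr_p nd pH]]]; exists p, (d ^ h)%g; split=> //.
  by rewrite cycleJ normalJ.
move: pH; have [_ nH] := andP nd; rewrite /pgroup !card_quotient //=.
  by rewrite cycleJ indexJg.
by rewrite cycleJ normJ conjSg.
Qed.

(** A subgroup of the integers contained in no p Z is everything: a nonzero
    element of least absolute value other than 1 would have a prime divisor p,
    and Bezout's identity with an element prime to p gives a smaller one. *)
Lemma int_subgroup_one (J : int -> Prop) :
  (forall a b, J a -> J b -> J (a - b)) ->
  (forall p : nat, prime p -> exists2 a, J a & ~~ (p %| `|a|)%N) -> J 1.
Proof.
move=> JB Jp; have [a0 Ja0 a0nz] := Jp 2%N isT.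
have J0 : J 0 by rewrite -(subrr a0); apply: JB.
have JN a : J a -> J (- a) by move=> Ja; rewrite -sub0r; apply: JB.
have JD a b : J a -> J b -> J (a + b) by move=> Ja /JN Jb; rewrite -[b]opprK;
  apply: JB.
have JMn a (n : nat) : J a -> J (a *+ n).
  by move=> Ja; elim: n => // n IHn; rewrite mulrS; apply: JD.
have JM a u : J a -> J (u * a).
  move=> Ja; case: u => n; first by rewrite -natz mulr_natl; apply: JMn.
  by rewrite NegzE mulNr -natz mulr_natl; apply/JN/JMn.
have [n] := ubnP `|a0|%N; have : (0 < `|a0|)%N by case: `|a0|%N a0nz.
elim: n a0 {a0nz} Ja0 => // n IHn a Ja a_gt0 lean.
have [a1|an1] := eqVneq `|a|%N 1%N.
  have [e|e] : a = 1 \/ a = - 1 by lia.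
    by rewrite -e.
  by rewrite -[1]opprK -e; apply: JN.
have pr_p : prime (pdiv `|a|) by rewrite pdiv_prime //; lia.
have [b Jb ndvd] := Jp _ pr_p; have [u [v uv]] := Bezoutz a b.
have dv : (`|gcdz a b| %| `|a|)%N by rewrite dvdn_gcdl.
have dvb : (`|gcdz a b| %| `|b|)%N by rewrite dvdn_gcdr.
apply: (IHn (gcdz a b)); first by rewrite -uv; apply: JD; apply: JM.
  by rewrite lt0n; apply: contraTneq dv => ->; rewrite dvd0n -lt0n.
rewrite ltnS in lean; apply: leq_trans lean.
rewrite ltn_neqAle dvdn_leq // andbT.
by apply: contraNneq ndvd => e; rewrite e in dvb;
  rewrite (dvdn_trans (pdiv_dvd _) dvb).
Qed.

(** For each x the values at x of virtual permutation characters form a subgroup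
    of the integers contained in no p Z, so some f takes the value 1 at x. If f
    is 1 on s and g is 1 at x then f + g - f g is 1 on both: the set where the
    value is 1 can be enlarged point by point. *)
Lemma virtual_perm_char_one : virtual_perm_char (fun=> 1).
Proof.
have ex1 x : exists2 f, virtual_perm_char f & f x = 1.
  apply: (@int_subgroup_one (fun a => exists2 f,
    virtual_perm_char f & f x = a)).
    move=> _ _ [f vf <-] [g vg <-]; exists (fun x => f x - g x) => //.
    by apply: virtual_perm_charD => //; apply: virtual_perm_charN.
  move=> p /(hyperelementary_fix x)[H [hypH ndvd]].
  exists (#|[set A in rcosets H setT | A :* x == A]|%:Z) => //.
  exists (fun x => #|[set A in rcosets H setT | A :* x == A]|%:Z) => //.
  exists (fun x => #|[set A in rcosets H setT | A :* x == A]|%:Z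
                   + #|[set A in rcosets H setT | A :* x == A]|%:Z),
    (fun x => #|[set A in rcosets H setT | A :* x == A]|%:Z).
  split; [apply: perm_charD| |] => *; try by apply: perm_char_rcosets => h;
    apply: (hyperF (hyperelementaryJ h hypH)).
  by rewrite addrK.
suff [f vf f1] : exists2 f, virtual_perm_char f & {in enum gT, forall x,
  f x = 1}.
  have [f1' [f2 [p1 p2 e]]] := vf; exists f1', f2; split=> // g.
  by rewrite -e f1 ?mem_enum.
elim: (enum gT) => [|x s [f vf fs]].
  by have [f vf _] := ex1 1%g; exists f.
have [g vg gx] := ex1 x; exists (fun x => f x + g x + - (f x * g x)).
  apply: virtual_perm_charD; first exact: virtual_perm_charD.
  by apply: virtual_perm_charN; apply: virtual_perm_charM.
move=> z; rewrite inE => /predU1P[->|/fs ->];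
  first by rewrite gx mulr1 [f x + 1]addrC addrK.
by rewrite mul1r addrK.
Qed.

Lemma solomon_induction : exists (X Y : finType) (toX : {action gT &-> X})
  (toY : {action gT &-> Y}),
  [/\ stabilizers_in toX, stabilizers_in toY &
      forall g, #|fixed_points toX g| = (1 + #|fixed_points toY g|)%N].
Proof.
have [f1 [f2 [[X [toX [FX eX]]] [Y [toY [FY eY]]] e]]] := virtual_perm_char_one.
exists X, Y, toX, toY; split=> // g.
by apply/eqP; rewrite -eqz_nat PoszD -eY -eX -subr_eq -e.
Qed.
End PermutationCharacters.

Local Open Scope ring_scope.

(** * Traces determine representations *)

Section Trace.
Variables (F : closedFieldType) (gT : finGroupType) (G : {group gT}).
Hypothesis charF : [pchar F] =i pred0.

Let F'G : [pchar F]^'.-group G.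
Proof.
rewrite /pgroup (eq_pnat _ (eq_negn charF)).
by apply/pnatP=> // p _ _; rewrite !inE.
Qed.

Let sG : irrType F G := DecSocleType (regular_repr F G).

Lemma gring_op_sum n (rG : mx_representation F G n) A :
  gring_op rG A = \sum_i gring_row A 0 i *: rG (enum_val i).
Proof.
rewrite gring_opE [in LHS](row_sum_delta (gring_row A)) linear_sum /=.
apply: eq_bigr => i _; rewrite linearZ /=; congr (_ *: _).
by rewrite /gring_mx /= -rowE rowK mxvecK.
Qed.

(** Used both for isomorphisms and for the inclusion of a submodule. *)
Lemma gring_op_intertwine n1 n2 (rG1 : mx_representation F G n1)
    (rG2 : mx_representation F G n2) (B : 'M_(n1, n2)) A :
  (forall x, x \in G -> rG1 x *m B = B *m rG2 x) ->
  gring_op rG1 A *m B = B *m gring_op rG2 A.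
Proof.
move=> homB; rewrite !gring_op_sum mulmx_suml mulmx_sumr.
by apply: eq_bigr => i _; rewrite -scalemxAl -scalemxAr homB ?enum_valP.
Qed.

Lemma mxtrace_idem n (E : 'M[F]_n) : E *m E = E -> \tr E = (\rank E)%:R.
Proof.
move=> idE; have := mulmx_base E; move: (col_base_full E) (row_base_free E).
move: (col_base E) (row_base E) => c r fullc freer cr.
rewrite -[in LHS]cr mxtrace_mulC; suff -> : r *m c = 1%:M by rewrite mxtrace1.
apply: (row_free_inj freer); apply: (row_full_inj fullc).
by rewrite mul1mx !mulmxA cr -mulmxA cr.
Qed.

Lemma pchar0_natr_inj : injective (fun n : nat => n%:R : F).
Proof.
have nz m : (0 < m)%N -> m%:R != 0 :> F by move/(pcharf0P _): charF => ->;
  rewrite -lt0n.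
move=> m n; wlog lemn : m n / (m <= n)%N.
  by move=> W /= e; have /orP[/W|/W] := leq_total m n;
    [apply|move=> /(_ (esym e))].
move=> /= e; apply/eqP; rewrite eqn_leq lemn -subn_eq0; apply/negPn/negP => nz'.
by have:= nz (n - m)%N; rewrite lt0n nz' natrB // e subrr eqxx => /(_ isT).
Qed.

Lemma val_submod_op n (rG : mx_representation F G n) U (modU : mxmodule rG U)
  A :
  gring_op (submod_repr modU) A *m val_submod 1%:M = val_submod 1%:M *m
    gring_op rG A.
Proof.
apply: gring_op_intertwine => x Gx.
by rewrite -val_submodE -[submod_repr _ x]mul1mx val_submodJ.
Qed.

(** The Wedderburn idempotent of i kills every simple module of another type, so
    if it acts nontrivially then some summand of a decomposition of rG into
    simple modules has type i. *)
Lemma simple_of_op_id n (rG : mx_representation F G n) (i : sG) :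
  gring_op rG (Wedderburn_id i) != 0 ->
  exists (U : 'M_n) (modU : mxmodule rG U),
    mx_irreducible (submod_repr modU) /\ irr_comp sG (submod_repr modU) = i.
Proof.
move=> nz; have [I U /= simU defU _] := dec_mx_reducible_semisimple
  (mxmodule1 rG) (mx_Maschke_pchar rG F'G).
have [j nzj] : exists j, U j *m gring_op rG (Wedderburn_id i) != 0.
  apply/existsP; rewrite -[X in is_true X]negbK negb_exists; apply: contra nz.
  move/forallP => z; rewrite -submx0 -[gring_op _ _]mul1mx.
  apply: (submx_trans (submxMr _ _)); first by rewrite -defU; exact: submx_refl.
  rewrite sumsmxMr; apply/sumsmx_subP => j _.
  by move: (z j); rewrite negbK => /eqP ->.
have modU := mxsimple_module (simU j).
have irrU : mx_irreducible (submod_repr modU) by apply/submod_mx_irr.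
exists (U j), modU; split=> //; apply/eqP; apply: contraNT nzj => ne.
rewrite -submx0.
apply: (submx_trans (submxMr _ (_ : (U j <= val_submod 1%:M)%MS))).
  by rewrite val_submod1.
by rewrite -val_submod_op (irr_comp'_op0_pchar F'G irrU _ (Wedderburn_id_mem i))
  ?mul0mx ?sub0mx // eq_sym.
Qed.

Lemma irr_op_id_neq0 n (rG : mx_representation F G n) U (modU : mxmodule rG U) :
  mx_irreducible (submod_repr modU) ->
  gring_op rG (Wedderburn_id (irr_comp sG (submod_repr modU))) != 0.
Proof.
move=> irrU; set i := irr_comp _ _.
have [B eqn freeB homB] := mx_rsim_sym (rsim_irr_comp_pchar sG F'G irrU).
have := gring_op_intertwine (Wedderburn_id i) homB.
rewrite op_Wedderburn_id_pchar // mul1mx => eB.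
apply/eqP => z; have := val_submod_op modU (Wedderburn_id i).
rewrite z mulmx0 -val_submodE => /eqP; rewrite val_submod_eq0 => /eqP z'.
move: freeB; rewrite eB z' mulmx0 /row_free mxrank0 => /eqP r0.
by have := irr_degree_gt0 i; rewrite -r0.
Qed.

(** Induction on the degree. For a simple submodule of rG1 of type i, the
    Wedderburn idempotent of i acts on rG1 and rG2 as idempotents with the same
    trace, which in characteristic zero is their rank; so rG2 contains a simple
    module of type i as well. Splitting off both by Maschke's theorem leaves
    representations with equal traces. *)
Lemma mx_rsim_mxtrace (rG1 rG2 : representation F G) :
  (forall x, x \in G -> \tr (rG1 x) = \tr (rG2 x)) -> mx_rsim rG1 rG2.
Proof.
have [n] := ubnP (rdegree rG1).
elim: n => // n IHn in rG1 rG2 *; case: rG1 rG2 =>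
  [n1 rG1] [n2 rG2] /= ltn tr12.
have eqn : n1 = n2.
  by apply: pchar0_natr_inj; have := tr12 1%g (group1 G);
    rewrite !repr_mx1 !mxtrace1.
have [n0|n_gt0] := posnP n1.
  exists 0; rewrite // ?/row_free ?mxrank0 ?n0 // => x _.
  by rewrite mulmx0 mul0mx.
have nz1 : (1%:M : 'M[F]_n1) != 0.
  by apply/eqP => /(congr1 mxrank); rewrite mxrank1 mxrank0 => z;
    rewrite z in n_gt0.
have [U1 simU1 _] := dec_mxsimple_exists (mxmodule1 rG1) nz1.
have modU1 := mxsimple_module simU1.
have irrU1 : mx_irreducible (submod_repr modU1) by apply/submod_mx_irr.
have := irr_op_id_neq0 irrU1; set i := irr_comp _ _ => nzi.
have idi n' (rG : mx_representation F G n') :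
    gring_op rG (Wedderburn_id i) *m gring_op rG (Wedderburn_id i)
    = gring_op rG (Wedderburn_id i).
  have [_ /= mi _ /(_ _ (Wedderburn_id_mem i)) ii] :=
    Wedderburn_is_id_pchar F'G i.
  by rewrite -gring_opM ?ii // -(Wedderburn_sum_pchar sG F'G) (sumsmx_sup i).
have tri : \tr (gring_op rG1 (Wedderburn_id i)) =
  \tr (gring_op rG2 (Wedderburn_id i)).
  rewrite !gring_op_sum ![mxtrace _](raddf_sum (@mxtrace _ _)) /=;
    apply: eq_bigr => j _.
  by rewrite ![mxtrace (_ *: _)]mxtraceZ tr12 ?enum_valP.
have /simple_of_op_id[U2 [modU2 [irrU2 irr2]]] :
    gring_op rG2 (Wedderburn_id i) != 0.
  rewrite -mxrank_eq0 -(inj_eq pchar0_natr_inj) -mxtrace_idem // -tri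
    mxtrace_idem //.
  by rewrite (inj_eq pchar0_natr_inj) mxrank_eq0.
have simU12 : mx_rsim (submod_repr modU1) (submod_repr modU2).
  apply: mx_rsim_trans (rsim_irr_comp_pchar sG F'G irrU1) (mx_rsim_sym _).
  by rewrite -/i -irr2; apply: rsim_irr_comp_pchar.
have [W1 modW1 defW1 dxW1] := mx_Maschke_pchar rG1 F'G modU1 (submx1 _).
have [W2 modW2 defW2 dxW2] := mx_Maschke_pchar rG2 F'G modU2 (submx1 _).
have trW x : x \in G -> \tr (submod_repr modW1 x) = \tr (submod_repr modW2 x).
  move=> Gx; apply: (addrI (\tr (submod_repr modU1 x))).
  rewrite (mxtrace_dadd_mod modU1 modW1 (mxmodule1 _) defW1 dxW1 Gx).
  rewrite [in RHS](mxtrace_rsim simU12) //.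
  rewrite (mxtrace_dadd_mod modU2 modW2 (mxmodule1 _) defW2 dxW2 Gx).
  by rewrite !mxtrace_submod1 // tr12.
have simW : mx_rsim (submod_repr modW1) (submod_repr modW2).
  apply: (IHn (Representation (submod_repr modW1)) (Representation (submod_repr
    modW2))) => //=.
  have := mxdirectP dxW1 => /=; rewrite defW1 mxrank1 => e.
  apply: leq_trans (_ : n1 <= n)%N => //; rewrite [leqRHS]e.
  by rewrite -[ltnLHS]add0n ltn_add2r lt0n mxrank_eq0; case: simU1.
have s1 := mx_rsim_dadd (mxmodule1 rG1) defW1 dxW1
  (rU := Representation (submod_repr modU2))
  (rV := Representation (submod_repr modW2)) simU12 simW.
have s2 := mx_rsim_dadd (mxmodule1 rG2) defW2 dxW2
  (rU := Representation (submod_repr modU2))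
  (rV := Representation (submod_repr modW2)) (mx_rsim_refl _) (mx_rsim_refl _).
apply: mx_rsim_trans (mx_rsim_trans (mx_rsim_sym (rsim_submod1 (mxmodule1 rG1)
  _)) s1) _ => //.
exact: mx_rsim_trans (mx_rsim_sym s2) (rsim_submod1 (mxmodule1 rG2) _).
Qed.
End Trace.

(** * Lines permuted by a projective representation *)

Section Eigen.
Variable F : closedFieldType.

Lemma separable_XnsubC (k : nat) (c : F) :
  k%:R != 0 :> F -> c != 0 -> separable_poly ('X^k - c%:P).
Proof.
move=> nzk nzc; have k_gt0 : (0 < k)%N by case: k nzk => //; rewrite eqxx.
rewrite unlock derivB derivC subr0 derivXn -scaler_nat.
rewrite coprimepZr //; apply: coprimep_expr.
have := coprimep_XsubC ('X^k - c%:P) 0; rewrite subr0 => ->.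
rewrite rootE !hornerE expr0n.
by rewrite gtn_eqF // sub0r oppr_eq0.
Qed.

(** A is a root of 'X^k - c, which has distinct roots. *)
Lemma diagonalizable_of_power r (A : 'M[F]_r.+1) k c :
  k%:R != 0 :> F -> c != 0 -> A ^+ k = c%:M ->
  exists rs : seq F, [/\ uniq rs,
     (1%:M <= \sum_(i < size rs) eigenspace A rs`_i)%MS
   & forall mu, eigenspace A mu != 0 -> mu \in rs].
Proof.
move=> nzk nzc Ak; set p : {poly F} := 'X^k - c%:P.
have k_gt0 : (0 < k)%N by case: k nzk {Ak p} => //; rewrite eqxx.
have monp : p \is monic by rewrite monicXnsubC.
have [rs] := closed_field_poly_normal p; rewrite (monicP monp) scale1r => defp.
have urs : uniq rs by rewrite -separable_prod_XsubC -defp separable_XnsubC.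
have Ap : horner_mx A p = 0.
  by rewrite rmorphB rmorphXn /= horner_mx_X horner_mx_C Ak subrr.
exists rs; split=> // [|mu].
  have kp : (1%:M <= kermxpoly A p)%MS by rewrite sub_kermx Ap mulmx0.
  apply: submx_trans kp _; rewrite defp (big_nth 0) big_mkord.
  rewrite kermxpoly_prod => [|i j _ _ ne].
    by apply/sumsmx_subP => i _; rewrite -eigenspace_poly (sumsmx_sup i).
  rewrite coprimep_XsubC root_XsubC; apply: contra ne => /eqP e.
  by apply/eqP/val_inj/eqP; rewrite -(nth_uniq 0 (ltn_ord j) (ltn_ord i) urs) e.
move=> nz; rewrite -root_prod_XsubC -defp; have [v vE nzv] := rowV0Pn nz.
have := eigenspaceP vE => vA; rewrite rootE; apply: contraNT nzv => nzp.
have : v *m horner_mx A p = p.[mu] *: v.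
  rewrite rmorphB rmorphXn /= horner_mx_X horner_mx_C !hornerE scalerBl.
  rewrite mulmxBr mul_mx_scalar; congr (_ - _).
  elim: k {nzk Ak p k_gt0 monp defp Ap nzp} => [|k IHk];
    first by rewrite expr0 mulmx1 expr0 scale1r.
  by rewrite !exprS -mulmxE mulmxA vA -scalemxAl IHk scalerA.
by rewrite Ap mulmx0 => /esym/eqP; rewrite scaler_eq0 (negbTE nzp).
Qed.
End Eigen.

Section Frames.
Variables (F : fieldType) (gT : finGroupType) (n : nat).
Variables (M : gT -> 'M[F]_n) (c : gT -> gT -> F).
Hypothesis cN0 : forall g h, c g h != 0.
Hypothesis MM : forall g h, M g *m M h = c g h *: M (g * h)%g.
Hypothesis Munit : forall g, M g \in unitmx.

(** Bases are handled as sequences of vectors, since they are built by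
    concatenation; a sequence of length at most the rank that spans is a
    basis. *)
Definition row_span (s : seq 'rV[F]_n) : 'M_n := (\sum_(v <- s) <<v>>)%MS.

Definition stabset m (K : {set gT}) (U : 'M_(m, n)) : {set gT} :=
  [set g in K | (U *m M g <= U)%MS].

(** The lines of a basis of U are permuted by K. The vectors are only required
    to span U and to be at most \rank U in number, so none is superfluous. *)
Definition frame m (K : {set gT}) (U : 'M_(m, n)) : Prop :=
  exists s : seq 'rV[F]_n, [/\ (size s <= \rank U)%N, (U <= row_span s)%MS
    & forall g v, g \in K -> v \in s ->
        exists2 w, w \in s & (v *m M g <= w)%MS].

Lemma span_subP s m (W : 'M_(m, n)) :
  reflect (forall v, v \in s -> (v <= W)%MS) (row_span s <= W)%MS.
Proof.
rewrite /row_span; elim: s => [|v s IHs]; first by rewrite big_nil sub0mx;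
  constructor.
rewrite big_cons addsmx_sub genmxE; apply: (iffP andP) => [[vW /IHs sW] w|sW].
  by rewrite inE => /predU1P[->|/sW].
by split; [apply: sW; rewrite mem_head | apply/IHs => w ws; apply: sW;
  rewrite inE ws orbT].
Qed.

Lemma mem_span s v : v \in s -> (v <= row_span s)%MS.
Proof. exact: (span_subP s (row_span s) (submx_refl _)). Qed.

Lemma sub_projrepM g h m1 m2 (X : 'M_(m1, n)) (Y : 'M_(m2, n)) :
  (X *m M g *m M h <= Y)%MS = (X *m M (g * h)%g <= Y)%MS.
Proof. by rewrite -mulmxA MM -scalemxAr eqmx_scale. Qed.

Lemma projrep1 : M 1%g = c 1%g 1%g *: 1%:M.
Proof.
have : M 1%g *m M 1%g = c 1%g 1%g *: M 1%g by rewrite MM mulg1.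
by move/(canRL (mulmxK (Munit _))); rewrite -scalemxAl mulmxV.
Qed.

Lemma projrepV g : exists2 d, d != 0 & M g^-1%g = d *: invmx (M g).
Proof.
exists (c g^-1%g g * c 1%g 1%g); first by rewrite mulf_neq0.
have := MM g^-1%g g; rewrite mulVg projrep1 scalerA.
by move/(canRL (mulmxK (Munit _))); rewrite -scalemxAl mul1mx.
Qed.

Lemma sub_projrep1 m1 m2 (X : 'M_(m1, n)) (Y : 'M_(m2, n)) :
  (X *m M 1%g <= Y)%MS = (X <= Y)%MS.
Proof. by rewrite projrep1 -scalemxAr mulmx1 eqmx_scale. Qed.

Lemma sub_projrep_trans g h m1 m2 m3
    (X : 'M_(m1, n)) (Y : 'M_(m2, n)) (Z : 'M_(m3, n)) :
  (X *m M g <= Y)%MS -> (Y *m M h <= Z)%MS -> (X *m M (g * h)%g <= Z)%MS.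
Proof. by move=> XY YZ; rewrite -sub_projrepM;
  apply: submx_trans (submxMr _ XY) YZ. Qed.

Lemma sub_projrepV g m1 m2 (X : 'M_(m1, n)) (Y : 'M_(m2, n)) :
  (X <= Y *m M g)%MS = (X *m M g^-1%g <= Y)%MS.
Proof.
have [d nzd ->] := projrepV g; rewrite -scalemxAr eqmx_scale //.
have free : row_free (M g) by rewrite row_free_unit.
by rewrite -[RHS](submxMfree _ _ free) mulmxKV.
Qed.

Lemma sub_projrepVr g m1 m2 (X : 'M_(m1, n)) (Y : 'M_(m2, n)) :
  (X *m M g <= Y)%MS = (X <= Y *m M g^-1%g)%MS.
Proof. by rewrite sub_projrepV invgK. Qed.

Lemma stabset_group (K : {group gT}) m (U : 'M_(m, n)) :
  group_set (stabset K U).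
Proof.
apply/group_setP; split; first by rewrite inE group1 sub_projrep1 submx_refl.
move=> g h; rewrite !inE => /andP[Kg gU] /andP[Kh hU].
by rewrite groupM // (sub_projrep_trans gU hU).
Qed.

Lemma frameS m (K L : {set gT}) (U : 'M_(m, n)) : L \subset K -> frame K U ->
  frame L U.
Proof.
move=> /subsetP LK [s [sz sp st]]; exists s; split=> // g v /LK; exact: st.
Qed.

(** If U is the direct sum of subspaces permuted by K, frames for the
    stabilisers of these subspaces give a frame for K: choose one subspace in
    each orbit, and carry its frame to the others. *)
Section Glue.
Variables (K : {group gT}) (m : nat) (U : 'M[F]_(m, n)).
Variables (I : finType) (U_ : I -> 'M[F]_n) (al : I -> gT -> I).
Hypothesis nzU : forall i, U_ i != 0.
Hypothesis dxU : mxdirect (\sum_i U_ i).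
Hypothesis sumU : (U <= \sum_i U_ i)%MS.
Hypothesis subU : forall i, (U_ i <= U)%MS.
Hypothesis alU : forall i g, g \in K -> (U_ i *m M g <= U_ (al i g))%MS.
Hypothesis frU : forall i, frame (stabset K (U_ i)) (U_ i).

Let M_inj p (X : 'M_(p, n)) g : X *m M g = 0 -> X = 0.
Proof. by move/(canRL (mulmxK (Munit _))); rewrite mul0mx. Qed.

Let al_uniq i g j : (U_ i *m M g <= U_ j)%MS -> g \in K -> al i g = j.
Proof.
move=> ij Kg; apply/eqP/negPn/negP => ne; have := nzU i; case/eqP.
apply/(@M_inj _ _ g)/eqP; rewrite -submx0.
have /mxdirect_sumsP/(_ j isT) <- := dxU; rewrite sub_capmx ij /=.
by rewrite (sumsmx_sup (al i g)) // alU.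
Qed.

Let al1 i : al i 1%g = i.
Proof. by apply: al_uniq; rewrite ?sub_projrep1. Qed.

Let alM i g h : g \in K -> h \in K -> al i (g * h)%g = al (al i g) h.
Proof. by move=> Kg Kh; apply: al_uniq; rewrite ?groupM // (sub_projrep_trans
  (alU _ Kg)) ?alU. Qed.

Let e i j := [exists g in K, al i g == j].

Let e_eq i j : e i j -> e^~ i =1 e^~ j.
Proof.
move=> /exists_inP[g Kg /eqP <-] l; apply/exists_inP/exists_inP =>
  -[h Kh /eqP a].
  by exists (h * g)%g; rewrite ?groupM // alM // a.
by exists (h * g^-1)%g; rewrite ?groupM ?groupV // alM ?groupV // a -alM
  ?groupV // mulgV al1.
Qed.

Let e_refl i : e i i.
Proof. by apply/exists_inP; exists 1%g; rewrite ?al1. Qed.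

Let rep i := odflt i [pick j | e j i].

Let rep_e i : e (rep i) i.
Proof. by rewrite /rep; case: pickP => [j|_] //=; exact: e_refl. Qed.

Let rep_eq i j : e i j -> rep i = rep j.
Proof.
move=> eij; rewrite /rep (eq_pick (e_eq eij)); case: pickP => //= none.
by have := none j; rewrite e_refl.
Qed.

Lemma frame_glue : frame K U.
Proof.
have /fin_all_exists[k_ k_P] i : exists g, (g \in K) && (al (rep i) g == i).
  by have /exists_inP[g Kg a] := rep_e i; exists g; rewrite Kg.
have Kk i : k_ i \in K by have /andP[] := k_P i.
have alk i : al (rep i) (k_ i) = i by have /andP[_ /eqP] := k_P i.
have Uk i : (U_ (rep i) *m M (k_ i) <= U_ i)%MS by rewrite -[in X in (_ <=
  X)%MS](alk i) alU.
have UkV i : (U_ i *m M (k_ i)^-1%g <= U_ (rep i))%MS.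
  suff -> : rep i = al i (k_ i)^-1%g by rewrite alU ?groupV.
  by rewrite -{2}(alk i) -alM ?groupV // mulgV al1.
have [s_ s_P] := fin_all_exists frU.
exists (flatten [seq [seq v *m M (k_ i) | v <- s_ (rep i)] | i <- enum I]);
  split.
- rewrite size_flatten /shape -map_comp sumnE big_map big_enum /=.
  apply: (@leq_trans (\rank (\sum_i U_ i)%MS)); last first.
    by apply: mxrankS; apply/sumsmx_subP => i _.
  rewrite (mxdirectP dxU) /=; apply: leq_sum => i _; rewrite size_map.
  have [sz _ _] := s_P (rep i); apply: leq_trans sz _.
  rewrite -(mxrankMfree _ (_ : row_free (M (k_ i)))) ?row_free_unit //.
  exact: mxrankS.
- apply: submx_trans sumU _; apply/sumsmx_subP => i _.
  have := UkV i; rewrite -sub_projrepV => /submx_trans; apply.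
  have [_ sp _] := s_P (rep i); rewrite sub_projrepVr.
  apply: submx_trans sp _; apply/span_subP => v vs; rewrite -sub_projrepVr.
  apply: mem_span; apply/flattenP.
  exists [seq v *m M (k_ i) | v <- s_ (rep i)]; last exact: map_f.
  by apply: map_f; rewrite mem_enum.
move=> g v Kg /flattenP[_ /mapP[i _ ->] /mapP[w ws ->]].
set j := al i g.
have rij : rep i = rep j by apply: rep_eq; apply/exists_inP; exists g.
(* k_ i * g = h * k_ j with h stabilising the chosen subspace of the orbit *)
have Kh : (k_ i * g * (k_ j)^-1)%g \in stabset K (U_ (rep i)).
  rewrite inE !groupM ?groupV //= -sub_projrepM.
  have := UkV j; rewrite -rij; apply: submx_trans; apply: submxMr.
  exact: sub_projrep_trans (Uk i) (alU _ Kg).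
have [_ _ /(_ _ _ Kh ws)[w' w's ww']] := s_P (rep i).
exists (w' *m M (k_ j)).
  apply/flattenP; exists [seq v *m M (k_ j) | v <- s_ (rep j)].
    by apply: map_f; rewrite mem_enum.
  by apply: map_f; rewrite -rij.
by rewrite sub_projrepM sub_projrepV sub_projrepM.
Qed.
End Glue.
End Frames.

Section EigenFrames.
Variables (F : closedFieldType) (gT : finGroupType) (n : nat).
Variables (M : gT -> 'M[F]_n) (c : gT -> gT -> F).
Hypothesis charF : [pchar F] =i pred0.
Hypothesis cN0 : forall g h, c g h != 0.
Hypothesis MM : forall g h, M g *m M h = c g h *: M (g * h)%g.
Hypothesis Munit : forall g, M g \in unitmx.

(** Some power of a is 1, so that a power of the matrix of M a on V is a scalar
    and that matrix is diagonalisable. *)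
Lemma eigen_split_free a r (V : 'M_(r, n)) :
  row_free V -> (V *m M a <= V)%MS ->
  exists rs : seq F, [/\ uniq rs,
     (V <= \sum_(i < size rs) (V :&: eigenspace (M a) rs`_i))%MS
   & forall mu, (V :&: eigenspace (M a) mu)%MS != 0 -> mu \in rs].
Proof.
case: r V => [|r] V freeV stV.
  exists [::]; split=> // [|mu]; rewrite flatmx0 ?sub0mx // cap0mx; case/eqP.
  by [].
pose A := V *m M a *m pinvmx V.
have AV : A *m V = V *m M a by rewrite mulmxKpV.
have Aj j : exists2 d, d != 0 & A ^+ j *m V = d *: (V *m M (a ^+ j)%g).
  elim: j => [|j [d nzd IHj]].
    exists (c 1%g 1%g)^-1; rewrite ?invr_neq0 // expr0 expg0 mul1mx.
    by rewrite (projrep1 MM Munit) -scalemxAr mulmx1 scalerA mulVf // scale1r.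
  exists (d * c a (a ^+ j)%g); first by rewrite mulf_neq0.
  rewrite exprS -mulmxE -mulmxA IHj -scalemxAr mulmxA AV.
  by rewrite -mulmxA MM -scalemxAr scalerA expgS.
have [d nzd Ao] := Aj #[a]%g.
have Ascal : A ^+ #[a]%g = (d * c 1%g 1%g)%:M.
  apply: (row_free_inj freeV); rewrite Ao expg_order (projrep1 MM Munit)
    -scalemxAr mulmx1 scalerA.
  by rewrite mul_scalar_mx.
have nzo : #[a]%g%:R != 0 :> F.
  by move/(pcharf0P _): charF => ->; rewrite -lt0n order_gt0.
have [rs [urs span_rs mem_rs]] := diagonalizable_of_power nzo (mulf_neq0 nzd
  (cN0 _ _)) Ascal.
exists rs; split=> // [|mu].
  rewrite -[X in (X <= _)%MS]mul1mx; apply: submx_trans (submxMr V span_rs) _.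
  rewrite sumsmxMr_gen; apply/sumsmx_subP => i _; apply: (sumsmx_sup i) => //.
  rewrite genmxE sub_capmx submxMl; apply/eigenspaceP.
  by rewrite -mulmxA -AV mulmxA (eigenspaceP (submx_refl _)) scalemxAl.
move=> /rowV0Pn[w]; rewrite sub_capmx => /andP[/submxP[x ->] /eigenspaceP ew
  nzw].
apply: mem_rs; apply/rowV0Pn; exists x.
  apply/eigenspaceP; apply: (row_free_inj freeV).
  by rewrite -mulmxA AV mulmxA ew scalemxAl.
by apply: contraNneq nzw => ->; rewrite mul0mx.
Qed.

Lemma eigen_split a m (U : 'M_(m, n)) :
  (U *m M a <= U)%MS ->
  exists rs : seq F, [/\ uniq rs,
     (U <= \sum_(i < size rs) (U :&: eigenspace (M a) rs`_i))%MS
   & forall mu, (U :&: eigenspace (M a) mu)%MS != 0 -> mu \in rs].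
Proof.
move=> stU; have eU := eq_row_base U.
have eUE E : (U :&: E :=: row_base U :&: E)%MS by apply/eqmxP;
  rewrite !(cap_eqmx eU (eqmx_refl E)) !submx_refl.
have [||rs [urs sp mem]] := @eigen_split_free a _ (row_base U).
- exact: row_base_free.
- by rewrite eU (eqmxMr _ eU).
exists rs; split=> // [|mu nz].
  rewrite -eU; apply: submx_trans sp _.
  by apply/sumsmx_subP => i _; rewrite (sumsmx_sup i) // eUE.
by apply: mem; rewrite -mxrank_eq0 -eUE mxrank_eq0.
Qed.

(** The stabilisers of the eigenspaces of M a suffice when K permutes them. *)
Lemma frame_eigenspaces a (K : {group gT}) m (U : 'M_(m, n)) :
  (U *m M a <= U)%MS ->
  (forall k, k \in K -> (U *m M k <= U)%MS) ->
  (forall k mu, k \in K -> exists nu,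
     ((U :&: eigenspace (M a) mu)%MS *m M k <= eigenspace (M a) nu)%MS) ->
  (forall mu, frame M (stabset M K (U :&: eigenspace (M a) mu)%MS)
                (U :&: eigenspace (M a) mu)%MS) ->
  frame M K U.
Proof.
move=> stU KU permE frE.
have [rs [urs sumU mem_rs]] := eigen_split stU.
pose E mu := (U :&: eigenspace (M a) mu)%MS.
pose rs' := [seq mu <- rs | E mu != 0].
pose lam (i : 'I_(size rs')) := rs'`_i.
have lam_inj : injective lam.
  by move=> i j /eqP; rewrite /lam nth_uniq ?filter_uniq // => /eqP/val_inj.
have lamE mu : E mu != 0 -> exists i, lam i = mu.
  move=> nz; have mu_rs' : mu \in rs' by rewrite mem_filter nz mem_rs.
  by have := mu_rs'; rewrite -index_mem => lt; exists (Ordinal lt);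
    rewrite /lam nth_index.
have nzE i : E (lam i) != 0.
  by have : lam i \in rs' by [exact: mem_nth]; rewrite mem_filter => /andP[].
have /fin_all_exists[al alP] i : exists al : gT -> 'I_(size rs'),
    forall k, k \in K -> (E (lam i) *m M k <= E (lam (al k)))%MS.
  apply: (fin_all_exists (P := fun k j => k \in K -> (E (lam i) *m M k <= E
    (lam j))%MS)) => k.
  have [Kk|] := boolP (k \in K); last by exists i.
  have [nu le_nu] := permE k (lam i) Kk.
  have le_E : (E (lam i) *m M k <= E nu)%MS.
    by rewrite sub_capmx le_nu andbT (submx_trans _ (KU k Kk)) // submxMr
      ?capmxSl.
  have [|j lj] := lamE nu; last by exists j; rewrite lj.
  apply: contraNneq (nzE i) => z; move: le_E; rewrite z submx0 => /eqP.
  by move/(canRL (mulmxK (Munit k))); rewrite mul0mx => ->.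
apply: (frame_glue cN0 MM Munit (U_ := fun i => E (lam i)) (al := al)) => //.
- apply/mxdirect_sumsP => i _; apply/eqP; rewrite -submx0.
  have /mxdirect_sumsP/(_ i isT) dxE :=
    mxdirect_sum_eigenspace (M a) (P := predT) (in2W lam_inj).
  rewrite -[X in (_ <= X)%MS]dxE; apply: capmxS; first exact: capmxSr.
  by apply/sumsmx_subP => j ji; apply: (sumsmx_sup j) => //; exact: capmxSr.
- apply: submx_trans sumU _; apply/sumsmx_subP => i _.
  rewrite -/(E rs`_i); have [->|nz] := eqVneq (E rs`_i) 0; first exact: sub0mx.
  have [j lj] := lamE _ nz.
  by apply: (sumsmx_sup j) => //; rewrite lj.
- by move=> i; apply: capmxSl.
- by move=> i; exact: frE.
Qed.
End EigenFrames.

Section PgroupFrames.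
Variables (F : closedFieldType) (gT : finGroupType) (n : nat).
Variables (M : gT -> 'M[F]_n) (c : gT -> gT -> F).
Hypothesis charF : [pchar F] =i pred0.
Hypothesis cN0 : forall g h, c g h != 0.
Hypothesis MM : forall g h, M g *m M h = c g h *: M (g * h)%g.
Hypothesis Munit : forall g, M g \in unitmx.

Definition scalar_on m (U : 'M_(m, n)) g := exists d, U *m M g = d *: U.

Lemma mul_projrepM m (U : 'M_(m, n)) g h : U *m M (g * h)%g =
  (c g h)^-1 *: (U *m M g *m M h).
Proof. by rewrite -mulmxA MM -scalemxAr scalerA mulVf // scale1r. Qed.

Lemma scalar_onS m1 m2 (U : 'M_(m1, n)) (W : 'M_(m2, n)) g :
  (W <= U)%MS -> scalar_on U g -> scalar_on W g.
Proof. by move=> /submxP[X ->] [d e]; exists d; rewrite -mulmxA e scalemxAr.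
Qed.

Lemma scalar_on1 m (U : 'M_(m, n)) : scalar_on U 1%g.
Proof. by exists (c 1%g 1%g); rewrite (projrep1 MM Munit) -scalemxAr mulmx1.
Qed.

Lemma scalar_onM m (U : 'M_(m, n)) g h :
  scalar_on U g -> scalar_on U h -> scalar_on U (g * h)%g.
Proof.
move=> [d eg] [d' eh]; exists ((c g h)^-1 * (d * d')).
by rewrite mul_projrepM eg -scalemxAl eh !scalerA.
Qed.

Lemma scalar_on_sub m (U : 'M_(m, n)) g : scalar_on U g -> (U *m M g <= U)%MS.
Proof. by move=> [d ->]; exact: scalemx_sub. Qed.

Definition scalar_set (K : {set gT}) m (U : 'M_(m, n)) : {set gT} :=
  [set g in K | `[< scalar_on U g >]].

Lemma scalar_set_group (K : {group gT}) m (U : 'M_(m, n)) :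
  group_set (scalar_set K U).
Proof.
apply/group_setP; split; first by rewrite inE group1; apply/asboolP/scalar_on1.
move=> g h; rewrite !inE => /andP[Kg /asboolP Ug] /andP[Kh /asboolP Uh].
by rewrite groupM //; apply/asboolP/scalar_onM.
Qed.

Lemma scalar_setJ (K : {group gT}) m (U : 'M_(m, n)) :
  (forall k, k \in K -> (U *m M k <= U)%MS) -> K \subset 'N(scalar_set K U).
Proof.
move=> KU; apply/subsetP => k Kk; rewrite inE; apply/subsetP =>
  _ /imsetP[t + ->].
rewrite !inE => /andP[Kt /asboolP Ut]; rewrite groupJ //; apply/asboolP.
have [d e] := scalar_onS (KU _ (groupVr Kk)) Ut.
have [d1 e1] := scalar_on1 U.
exists ((c k^-1%g (t * k)%g)^-1 * ((c t k)^-1 * (d * (c k^-1%g k * d1)))).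
rewrite conjgE mul_projrepM mul_projrepM e -scalemxAl -[U *m _ *m _]mulmxA MM
  mulVg -scalemxAr e1.
by rewrite !scalerA !mulrA.
Qed.

Lemma frame_scalar m (K : {set gT}) (U : 'M_(m, n)) :
  (forall k, k \in K -> scalar_on U k) -> frame M K U.
Proof.
move=> scU; exists [seq row i (row_base U) | i <- enum 'I_(\rank U)]; split.
- by rewrite size_map size_enum_ord.
- rewrite -(eq_row_base U); apply/row_subP => i.
  by apply/mem_span/map_f; rewrite mem_enum.
move=> g v Kg vs; exists v => //; apply/scalar_on_sub/(@scalar_onS m _ U);
  last exact: scU.
by case/mapP: vs => i _ ->; apply: submx_trans (row_sub _ _) _;
  rewrite eq_row_base.
Qed.

(** Let T be the subgroup of K acting on U by scalars. If T is not K, the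
    p-group K / T has a nontrivial central element, the class of some a. The
    commutators of a with K act by scalars, so K permutes the eigenspaces of
    M a, which are all smaller than U: conclude by induction on the rank
    of U. *)
Lemma frame_pgroup (p : nat) (S K : {group gT}) m (U : 'M_(m, n)) :
  S <| K -> p.-group (K / S) ->
  (forall k, k \in K -> (U *m M k <= U)%MS) ->
  (forall s, s \in S -> scalar_on U s) ->
  frame M K U.
Proof.
have [r] := ubnP (\rank U).
elim: r => // r IHr in m K U * => ltr nSK pKS KU SU.
pose T := Group (scalar_set_group K U).
have nKT : K \subset 'N(T) by apply: scalar_setJ.
have sTK : T \subset K by apply/subsetP => g; rewrite inE => /andP[].
have sST : S \subset T.
  apply/subsetP => s Ss; rewrite inE (subsetP (normal_sub nSK)) //=.
  exact/asboolP/SU.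
have pKT : p.-group (K / T).
  rewrite /pgroup card_quotient //; apply: pnat_dvd (_ : _ %| #|K : S|)%N _.
    by rewrite -(Lagrange_index sTK sST) dvdn_mulr.
  by rewrite -card_quotient ?normal_norm.
have [KT1|ntKT] := eqVneq (K / T)%g 1%g.
  apply: frame_scalar => k Kk; apply/asboolP.
  have : k \in T by apply: (subsetP _ k Kk); rewrite -quotient_sub1 ?KT1.
  by rewrite inE => /andP[].
have : 'Z(K / T)%g != 1%g.
  by rewrite (center_nil_eq1 (pgroup_nil pKT)).
case/trivgPn => ab /setIP[/morphimP[a Na Ka ->] /centP cab] nt_ab.
have Ta : a \notin T by apply: contraNN nt_ab => Ta; rewrite /= coset_id.
have comm k : k \in K -> [~ k, a] \in T.
  move=> Kk; have Nk := subsetP nKT k Kk; apply: coset_idr;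
    first by rewrite groupR.
  rewrite morphR //; apply/eqP/commgP/commute_sym; apply: cab;
    exact: mem_quotient.
apply: (frame_eigenspaces charF cN0 MM Munit (a := a)) => // [|k mu Kk|mu];
  first exact: KU.
  pose X := (U :&: eigenspace (M a) mu)%MS; rewrite -/X.
  have XU : (X <= U)%MS by apply: capmxSl.
  have Xa : X *m M a = mu *: X by apply/eigenspaceP; apply: capmxSr.
  have [d ed] : scalar_on (X *m M k) [~ k, a].
    apply: (@scalar_onS m _ U); first exact: submx_trans (submxMr _ XU) (KU k
      Kk).
    by have := comm k Kk; rewrite inE => /andP[_ /asboolP].
  (* k * a = a * k * [~ k, a], and the commutator acts as the scalar d *)
  exists (c k a * ((c (a * k)%g [~ k, a])^-1 * ((c a k)^-1 * (mu * d)))).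
  apply/eigenspaceP; rewrite -[in LHS]mulmxA MM -scalemxAr -[RHS]scalerA;
    congr (_ *: _).
  rewrite (_ : (k * a)%g = (a * k * [~ k, a])%g); last by rewrite -commgC.
  move: [~ k, a]%g ed => t ed; rewrite mul_projrepM mul_projrepM -!scalemxAl Xa
    -!scalemxAl ed !scalerA.
  by rewrite !mulrA.
pose X := (U :&: eigenspace (M a) mu)%MS; rewrite -/X.
have XU : (X <= U)%MS by apply: capmxSl.
have sSK' : S \subset stabset M K X.
  apply/subsetP => s Ss; rewrite inE (subsetP (normal_sub nSK)) //=.
  exact/scalar_on_sub/(scalar_onS XU)/SU.
have sK'K : stabset M K X \subset K by apply/subsetP => g; rewrite inE =>
  /andP[].
pose K' : {group gT} := Group (stabset_group cN0 MM Munit K X).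
apply: (IHr _ K').
- apply: leq_trans (_ : \rank U <= r)%N; last by rewrite -ltnS.
  apply: rank_ltmx; rewrite ltmxE XU /=; apply: contra Ta => UX.
  rewrite inE Ka; apply/asboolP; exists mu; apply/eigenspaceP.
  exact: submx_trans UX (capmxSr _ _).
- exact: (@normalS _ K K' S).
- by apply: pgroupS pKS; exact: (@quotientS _ _ K' K).
- by move=> k; rewrite inE => /andP[].
- by move=> s Ss; apply: scalar_onS XU (SU s Ss).
Qed.

(** As <[d]> is normal, H permutes the eigenspaces of M d. The stabiliser of an
    eigenspace contains <[d]>, which acts on it by scalars, so [frame_pgroup]
    applies there. *)
Lemma frame_hyperelementary (H : {group gT}) :
  hyperelementary H -> frame M H (1%:M : 'M_n).
Proof.
move=> [p [d [pr_p nd pH]]].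
have Xd mu z : z \in <[d]> ->
    scalar_on (1%:M :&: eigenspace (M d) mu)%MS z.
  case/cycleP => j ->; elim: j => [|j IHj]; first exact: scalar_on1.
  rewrite expgS; apply: scalar_onM IHj; exists mu.
  by apply/eigenspaceP; apply: capmxSr.
apply: (frame_eigenspaces charF cN0 MM Munit (a := d)) => [||h mu Hh|mu].
- exact: submx1.
- by move=> k _; exact: submx1.
- have [e ee] : scalar_on (1%:M :&: eigenspace (M d) mu)%MS (d ^ h^-1)%g.
    apply: Xd; rewrite memJ_norm ?cycle_id // groupV.
    exact: (subsetP (normal_norm nd)).
  set X := (_ :&: _)%MS in ee *.
  exists (c h d * ((c (d ^ h^-1)%g h)^-1 * e)); apply/eigenspaceP.
  rewrite -[in LHS]mulmxA MM -scalemxAr conjgCV mul_projrepM ee -!scalemxAl.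
  by rewrite !scalerA -?mulrA.
set X := (_ :&: _)%MS.
have sdK' : <[d]> \subset stabset M H X.
  apply/subsetP => s Ss; rewrite inE (subsetP (normal_sub nd)) //=.
  exact/scalar_on_sub/Xd.
have sK'H : stabset M H X \subset H by apply/subsetP => g; rewrite inE =>
  /andP[].
pose K' : {group gT} := Group (stabset_group cN0 MM Munit H X).
apply: (@frame_pgroup p <[d]>%G K').
- exact: (@normalS _ H K' <[d]>%G).
- by apply: pgroupS pH; exact: (@quotientS _ _ K' H).
- by move=> k; rewrite inE => /andP[].
- by move=> s Ss; apply: Xd.
Qed.
End PgroupFrames.

(** * Tensor products with permutation representations *)

Section TensorUnit.
Variable F : fieldType.

Lemma tensmx11 m n : (1%:M : 'M[F]_m) *t (1%:M : 'M[F]_n) = 1%:M.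
Proof.
apply/matrixP => i j; case: (mxtens_indexP i) => a b;
  case: (mxtens_indexP j) => a' b'.
by rewrite tensmxE !mxE (can_eq (@mxtens_indexK _ _)) xpair_eqE -mulnb natrM.
Qed.

Lemma tensmx_unitmx m n (A : 'M[F]_m) (B : 'M[F]_n) :
  A \in unitmx -> B \in unitmx -> A *t B \in unitmx.
Proof.
move=> uA uB; suff : (A *t B) *m (invmx A *t invmx B) = 1%:M by
  case/mulmx1_unit.
by rewrite tensmx_mul !mulmxV // tensmx11.
Qed.
End TensorUnit.

Section PermutationMatrices.
Variables (F : fieldType) (gT : finGroupType) (X : finType).
Variable to : {action gT &-> X}.

Definition perm_act_mx (g : gT) : 'M[F]_#|X| :=
  \matrix_(i, j) (to (enum_val i) g == enum_val j)%:R.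

Lemma perm_act_mx_repr : mx_repr [set: gT] perm_act_mx.
Proof.
split=> [|g h _ _]; apply/matrixP => i j; rewrite !mxE.
  by rewrite act1 (inj_eq enum_val_inj).
rewrite (bigD1 (enum_rank (to (enum_val i) g))) //= big1 => [|k ne];
  rewrite !mxE.
  by rewrite !enum_rankK eqxx mul1r addr0 actM.
rewrite (_ : _ == enum_val k = false) ?mul0r //; apply: contraNF ne => /eqP ->.
by rewrite enum_valK.
Qed.

Definition perm_act_repr := MxRepresentation perm_act_mx_repr.

Lemma mxtrace_perm_act g : \tr (perm_act_mx g) = #|fixed_points to g|%:R.
Proof.
rewrite /mxtrace -sum1_card natr_sum (reindex enum_rank) /=; last first.
  by apply: onW_bij; apply: enum_rank_bij.
rewrite [RHS]big_mkcond /=; apply: eq_bigr => x _.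
by rewrite !mxE enum_rankK inE; case: eqP.
Qed.
End PermutationMatrices.

Section InducedFrames.
Variables (F : fieldType) (gT : finGroupType) (n : nat).
Variables (M : gT -> 'M[F]_n) (c : gT -> gT -> F).
Hypothesis cN0 : forall g h, c g h != 0.
Hypothesis MM : forall g h, M g *m M h = c g h *: M (g * h)%g.
Hypothesis Munit : forall g, M g \in unitmx.
Variables (X : finType) (to : {action gT &-> X}).

Let M' g : 'M[F]_(#|X| * n) := perm_act_mx F to g *t M g.

Lemma tens_perm_unit g : M' g \in unitmx.
Proof.
apply: tensmx_unitmx => //.
exact: (repr_mx_unit (perm_act_repr F to) (in_setT g)).
Qed.

Lemma tens_permM g h : M' g *m M' h = c g h *: M' (g * h)%g.
Proof.
rewrite /M' tensmx_mul MM -(repr_mxM (perm_act_repr F to)) ?in_setT //.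
by apply/matrixP => i j; rewrite !mxE mulrCA.
Qed.

Let E x : 'M[F]_(n, #|X| * n) :=
  \matrix_(k, j) (((mxtens_unindex j).1 == enum_rank x)%:R * (k ==
    (mxtens_unindex j).2)%:R).

Let E_act x g : E x *m M' g = M g *m E (to x g).
Proof.
apply/matrixP => k l; case: (mxtens_indexP l) => a b {l}; rewrite !mxE.
under eq_bigr => u _ do rewrite !mxE mxtens_indexK /= mulrACA.
rewrite -(mulr_sum (fun i => (i == enum_rank x)%:R * (to (enum_val i) g ==
  enum_val a)%:R)
                   (fun j => (k == j)%:R * M g j b)).
rewrite (bigD1 (enum_rank x)) //= big1 ?addr0 => [|i /negbTE->];
  last by rewrite mul0r.
rewrite (bigD1 k) //= big1 ?addr0 => [|i]; last by rewrite eq_sym =>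
  /negbTE->; rewrite mul0r.
rewrite !eqxx !mul1r enum_rankK (bigD1 b) //= big1 ?addr0 => [|i /negbTE ne].
  by rewrite !mxE mxtens_indexK /= eqxx mulr1 mulrC -(inj_eq enum_rank_inj)
    enum_valK eq_sym.
by rewrite !mxE mxtens_indexK /= ne !mulr0.
Qed.

Let E_orth x y : E x *m (E y)^T = (x == y)%:R%:M.
Proof.
apply/matrixP => k l; rewrite !mxE.
under eq_bigr => u _ do rewrite !mxE mulrACA.
rewrite -(mulr_sum (fun i => (i == enum_rank x)%:R * (i == enum_rank y)%:R)
                   (fun j => (k == j)%:R * (l == j)%:R)).
rewrite (bigD1 (enum_rank x)) //= big1 ?addr0 => [|i /negbTE->];
  last by rewrite mul0r.
rewrite (bigD1 k) //= big1 ?addr0 => [|i]; last by rewrite eq_sym =>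
  /negbTE->; rewrite mul0r.
by rewrite !eqxx !mul1r (inj_eq enum_rank_inj) mulr_natr [l == k]eq_sym.
Qed.

Lemma span_mul p s (A : 'M[F]_(n, p)) : (row_span s *m A <= row_span [seq v *m
  A | v <- s])%MS.
Proof.
rewrite /row_span; elim: s => [|v s IHs]; first by rewrite /= big_nil mul0mx
  sub0mx.
rewrite /= !big_cons.
rewrite addsmxMr; apply: addsmxS IHs.
by rewrite genmxE submxMr // genmxE.
Qed.

(** The subspaces E x, copies of the space of M indexed by x \in X, are permuted
    as the points of X, so [frame_glue] applies. *)
Lemma frame_tens_perm :
  (forall x, frame M [set g | to x g == x] (1%:M : 'M_n)) ->
  frame M' [set: gT] (1%:M : 'M_(#|X| * n)).
Proof.
have [n0 _|n_gt0 frX] := posnP n.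
  exists [::]; split=> //.
  have e0 : (#|X| * n = 0)%N by rewrite n0 muln0.
  have -> : 1%:M = 0 :> 'M[F]_(#|X| * n) by apply/eqP;
    rewrite -mxrank_eq0 mxrank1 e0.
  exact: sub0mx.
have rE x : \rank (E x) = n.
  by apply/eqP/row_freeP; exists (E x)^T; rewrite E_orth eqxx.
have nz1 : (1%:M : 'M[F]_n) != 0 by rewrite -mxrank_eq0 mxrank1 -lt0n.
have fix_x x g : (E x *m M' g <= E x)%MS -> to x g = x.
  rewrite E_act => /submxP[Y eY]; apply/eqP/negPn/negP => ne.
  have := congr1 (mulmx^~ (E (to x g))^T) eY; rewrite -!mulmxA !E_orth eqxx.
  rewrite eq_sym (negbTE ne) mulmx1 mul_mx_scalar scale0r => Mg0.
  by have := Munit g; rewrite Mg0 -(mulmx0 _ (1%:M : 'M_n)) unitmx_mul unitmx1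
    /= unitmxE;
     case: n n_gt0 => // n' _; rewrite det0 unitr0.
apply: (frame_glue cN0 tens_permM tens_perm_unit (U_ := fun x =>
  <<E x>>%MS) (al := to)) => //.
- by move=> x; rewrite -mxrank_eq0 mxrank_gen rE -lt0n.
- apply/mxdirect_sumsP => x _; apply/eqP/rowV0P => v; rewrite sub_capmx genmxE.
  case/andP => /submxP[w ->] sub; have : (w *m E x *m (E x)^T <= (0 : 'M_n))%MS.
    apply: submx_trans (submxMr _ sub) _; rewrite sumsmxMr_gen;
      apply/sumsmx_subP => y ne.
    rewrite genmxE; apply: submx_trans (submxMr _ (_ : (_ <= E y)%MS)) _;
      first by rewrite genmxE.
    by rewrite E_orth (negbTE ne) raddf0 sub0mx.
  by rewrite submx0 -mulmxA E_orth eqxx mulmx1 => /eqP ->; rewrite mul0mx.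
- apply/row_subP => j; case: (mxtens_indexP j) => a b.
  apply: (sumsmx_sup (enum_val a)) => //; rewrite genmxE.
  suff -> : row (mxtens_index (a, b)) 1%:M = row b (E (enum_val a))
    by exact: row_sub.
  apply/rowP => l; case: (mxtens_indexP l) => a' b';
    rewrite !mxE mxtens_indexK /= enum_valK.
  rewrite (can_eq (@mxtens_indexK _ _)) xpair_eqE -mulnb natrM.
  by rewrite [a == a']eq_sym.
- by move=> x; exact: submx1.
- by move=> x g _; rewrite (eqmxMr _ (genmxE _)) genmxE E_act submxMl.
move=> x; have [s [sz sp st]] := frX x.
exists [seq v *m E x | v <- s]; split.
- by rewrite size_map mxrank_gen rE; apply: leq_trans sz _; rewrite mxrank1.
- rewrite genmxE -[X in (X <= _)%MS]mul1mx;
  apply: submx_trans (span_mul s (E x)).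
  exact: submxMr.
move=> g _ + /mapP[v vs ->]; rewrite !inE /= (eqmxMr _ (genmxE _)) genmxE =>
  /fix_x fx.
have fg : g \in [set g | to x g == x] by rewrite inE fx.
have [w ws vw] := st g v fg vs.
exists (w *m E x); first exact: map_f.
by rewrite -mulmxA E_act fx mulmxA submxMr.
Qed.

(** The rows of B are the vectors of s, completed by zeros if s were too short;
    they span, so B is invertible. *)
Lemma frame_basis : frame M [set: gT] (1%:M : 'M_n) ->
  exists2 B : 'M_n, B \in unitmx &
    forall g i, exists j d, row i (B *m M g) = d *: row j B.
Proof.
move=> [s [sz sp st]]; rewrite mxrank1 in sz.
pose B : 'M[F]_n := \matrix_(i < n) s`_i.
have spB : (row_span s <= B)%MS.
  apply/span_subP => v vs; have lt : (index v s < n)%N by apply: leq_trans sz;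
    rewrite index_mem.
  by have := row_sub (Ordinal lt) B; rewrite rowK /= nth_index.
have Bunit : B \in unitmx by rewrite -row_full_unit -sub1mx (submx_trans sp).
exists B => // g i; rewrite row_mul rowK.
have [ge|lt_i] := leqP (size s) i.
  by exists i, 0; rewrite nth_default // mul0mx scale0r.
have [w ws /sub_rVP[d ->]] := st g _ (in_setT g) (mem_nth 0 lt_i).
have lt : (index w s < n)%N by apply: leq_trans sz; rewrite index_mem.
by exists (Ordinal lt), d; rewrite rowK /= nth_index.
Qed.
End InducedFrames.

Section MonomialInduction.
Variables (F : closedFieldType) (gT : finGroupType) (n : nat).
Variables (M : gT -> 'M[F]_n) (c : gT -> gT -> F).
Hypothesis charF : [pchar F] =i pred0.
Hypothesis cN0 : forall g h, c g h != 0.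
Hypothesis MM : forall g h, M g *m M h = c g h *: M (g * h)%g.
Hypothesis Munit : forall g, M g \in unitmx.

(** B *m N g *m invmx B is a monomial matrix for every g. *)
Definition has_monomial_basis m (N : gT -> 'M[F]_m) :=
  exists2 B : 'M_m, B \in unitmx &
    forall g i, exists j d, row i (B *m N g) = d *: row j B.

Lemma triv_mx_repr : mx_repr [set: gT] (fun=> 1%:M : 'M[F]_1).
Proof. by split=> // g h _ _; rewrite mulmx1. Qed.

(** [solomon_induction] for the sets of elements of gT that permute the lines of
    a basis: this property passes to subsets for free, and holds for
    hyperelementary groups. *)
Lemma monomial_induction :
  exists (X Y : finType) (toX : {action gT &-> X}) (toY : {action gT &-> Y}),
    [/\ has_monomial_basis (fun g => perm_act_mx F toX g *t M g),
        has_monomial_basis (fun g => perm_act_mx F toY g *t M g)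
      & mx_rsim (perm_act_repr F toX)
          (dadd_grepr (Representation (MxRepresentation triv_mx_repr))
             (Representation (perm_act_repr F toY)))].
Proof.
have [||X [Y [toX [toY [stX stY fixXY]]]]] :=
    @solomon_induction gT (fun A => frame M A (1%:M : 'M_n)).
- by move=> A B; exact: frameS.
- by move=> H; exact: (frame_hyperelementary charF cN0 MM Munit).
exists X, Y, toX, toY; split.
- apply: frame_basis; exact: (frame_tens_perm cN0 MM Munit).
- apply: frame_basis; exact: (frame_tens_perm cN0 MM Munit).
have := mx_rsim_mxtrace charF (rG1 := Representation (perm_act_repr F toX))
  (rG2 := dadd_grepr (Representation (MxRepresentation triv_mx_repr))
     (Representation (perm_act_repr F toY))); apply => g _ /=.
by rewrite mxtrace_block mxtrace1 !mxtrace_perm_act fixXY natrD.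
Qed.
End MonomialInduction.

From mathcomp Require Import all_classical ereal topology.
From mathcomp Require Import freeg.

Local Close Scope group_scope.
Local Open Scope classical_set_scope.
Local Open Scope ring_scope.
Local Open Scope quotient_scope.

(** * Continuity for the valuation topology *)

Section Valuation.
Variables (C : topClosedFieldType) (v : C -> \bar rat).
Hypothesis val_v : valuation v.
Hypothesis nbhs_v : forall (x : C) (A : set C),
  nbhs x A <-> exists n : nat, forall y, val_ge v n (y - x) -> A y.

Let v0 x : v x = +oo%E <-> x = 0. Proof. by case: val_v. Qed.
Let vN x : v x <> -oo%E. Proof. by case: val_v. Qed.
Let vM x y : v (x * y) = (v x + v y)%E. Proof. by case: val_v. Qed.
Let vD x y : (mine (v x) (v y) <= v (x + y)%R)%E. Proof. by case: val_v. Qed.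

Lemma val1 : v 1 = 0%E.
Proof.
have := vM 1 1; rewrite mulr1; case e: (v 1) => [r||] //; last by have /vN := e.
  by case=> /eqP; rewrite -subr_eq0 opprD addrA subrr sub0r oppr_eq0 => /eqP ->.
by move/v0: e => /eqP; rewrite oner_eq0.
Qed.

Lemma valN x : v (- x) = v x.
Proof.
rewrite -mulN1r vM; suff -> : v (- 1) = 0%E by rewrite add0e.
have := vM (- 1) (- 1); rewrite mulrNN mulr1 val1; case: (v (-1)) => [r||] //.
by case=> /eqP; rewrite eq_sym -mulr2n mulrn_eq0 /= => /eqP ->.
Qed.

Lemma val_geD n x y : val_ge v n x -> val_ge v n y -> val_ge v n (x + y).
Proof.
rewrite /val_ge => nx ny; apply: Order.POrderTheory.le_trans (vD x y).
by rewrite le_min nx ny.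
Qed.

Lemma val_geN n x : val_ge v n (- x) = val_ge v n x.
Proof. by rewrite /val_ge valN. Qed.

Lemma val_geS m n x : (m <= n)%N -> val_ge v n x -> val_ge v m x.
Proof. by rewrite /val_ge => mn; apply: le_trans; rewrite lee_fin ler_nat. Qed.

Lemma val_geM m n x y : val_ge v m x -> val_ge v n y -> val_ge v (m + n)
  (x * y).
Proof. by rewrite /val_ge vM natrD EFinD => mx ny; apply: leeD. Qed.

(** Multiplication by x lowers the valuation by a bounded amount, because the
    valuation has no value -oo. *)
Lemma val_geMl x : exists m, forall n y, val_ge v (m + n) y ->
  val_ge v n (x * y).
Proof.
case e: (v x) => [r||]; last by have /vN := e.
  exists (Num.bound `|r|) => n y; rewrite /val_ge vM e.
  have := archi_boundP (normr_ge0 r); set m := Num.bound _ => ltm.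
  case ey: (v y) => [s||]; last by have /vN := ey.
    rewrite -EFinD !lee_fin natrD => le_s.
    by move: (ltW ltm); rewrite ler_norml => /andP[rm _]; lra.
  by move=> _; rewrite addey // leey.
exists 0%N => n y _; rewrite /val_ge vM e addye ?leey //.
by apply/eqP => /vN.
Qed.

Lemma val_separated x : x != 0 -> exists n, ~~ val_ge v n x.
Proof.
move=> nz; case e: (v x) => [r||]; first last.
- by have /vN := e.
- by move/v0: e nz => ->; rewrite eqxx.
exists (Num.bound `|r|); rewrite /val_ge e lee_fin -ltNge.
exact: le_lt_trans (ler_norm r) (archi_boundP (normr_ge0 r)).
Qed.

Lemma continuousP (T : topologicalType) (f : T -> C) :
  continuous f <-> forall t n, nbhs t [set u | val_ge v n (f u - f t)].
Proof.
split=> [cf t n|cf t A].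
  have := cf t [set y | val_ge v n (y - f t)]; apply.
  by apply/nbhs_v; exists n.
by move=> /nbhs_v[n nA]; apply: filterS (cf t n) => u /=; exact: nA.
Qed.

Lemma continuous_add (T : topologicalType) (f g : T -> C) :
  continuous f -> continuous g -> continuous (fun t => f t + g t).
Proof.
rewrite !continuousP => cf cg t n.
apply: filterS2 (cf t n) (cg t n) => u /= fu gu.
by rewrite opprD addrACA; apply: val_geD.
Qed.

Lemma continuous_mul (T : topologicalType) (f g : T -> C) :
  continuous f -> continuous g -> continuous (fun t => f t * g t).
Proof.
rewrite !continuousP => cf cg t n.
have [mf fP] := val_geMl (f t); have [mg gP] := val_geMl (g t).
apply: filterS2 (cf t (mg + n)%N) (cg t (mf + n)%N) => u /= fu gu.
rewrite (_ : _ - _ = (f u - f t) * (g u - g t) + (f t * (g u - g t) + g t * (f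
  u - f t))); last by ring.
apply: val_geD; last by apply: val_geD; [exact: fP | exact: gP].
apply: val_geS (val_geM fu gu); lia.
Qed.

Lemma neq0_open : open [set x : C | x != 0].
Proof.
rewrite openE => x /= nz; apply/nbhs_v; have [n nx] := val_separated nz.
exists n => y yx; apply: contraNneq nx => y0; by move: yx;
  rewrite y0 sub0r val_geN.
Qed.
End Valuation.

(** * Finite extensions and admissible functions *)

Section FiniteExtensions.
Variables (K : fieldType) (C : topClosedFieldType) (iota : {rmorphism K -> C}).
Hypothesis algC : forall x : C, algebraicOver iota x.

Definition lin_span (s : seq C) (x : C) : Prop :=
  exists c : 'I_(size s) -> K, x = \sum_i iota (c i) * s`_i.

Lemma lin_spanD s x y : lin_span s x -> lin_span s y -> lin_span s (x + y).
Proof.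
move=> [c ->] [d ->]; exists (fun i => c i + d i); rewrite -big_split /=.
by apply: eq_bigr => i _; rewrite rmorphD mulrDl.
Qed.

Lemma lin_spanZ s k x : lin_span s x -> lin_span s (iota k * x).
Proof.
move=> [c ->]; exists (fun i => k * c i); rewrite mulr_sumr.
by apply: eq_bigr => i _; rewrite rmorphM mulrA.
Qed.

Lemma lin_span0 s : lin_span s 0.
Proof. by exists (fun=> 0); rewrite big1 // => i _; rewrite rmorph0 mul0r. Qed.

Lemma lin_span_mem s x : x \in s -> lin_span s x.
Proof.
rewrite -index_mem => lt; exists (fun i => (i == Ordinal lt)%:R).
rewrite (bigD1 (Ordinal lt)) //= eqxx rmorph1 mul1r nth_index -?index_mem //.
by rewrite big1 ?addr0 // => i /negbTE ->; rewrite rmorph0 mul0r.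
Qed.

Lemma lin_span_sum s (I : finType) (f : I -> C) :
  (forall i, lin_span s (f i)) -> lin_span s (\sum_i f i).
Proof. by move=> sf; elim/big_ind: _ => *;
  [exact: lin_span0 | exact: lin_spanD |]. Qed.

(** If p is a polynomial with p(x) = 0 and p(0) != 0, obtained by dividing by X
    as long as the constant term vanishes, then x^-1 is a polynomial in x. *)
Lemma algebraic_inv_closed (S : subringClosed C) :
  (forall k, iota k \in S) -> {in S, forall x, x^-1 \in S}.
Proof.
move=> KS x Sx; have [->|nzx] := eqVneq x 0; first by rewrite invr0 rpred0.
have [p nzp rp] := algC x; have [m] := ubnP (size p).
elim: m p nzp rp => // m IHm; elim/poly_ind => [|p k _ nzp];
  first by rewrite eqxx.
rewrite rmorphD rmorphM /= map_polyX map_polyC rootE !hornerE => /eqP px ltm.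
have [k0|nzk] := eqVneq k 0.
  have nzp' : p != 0.
    by apply: contraNneq nzp => ->; rewrite k0 mul0r add0r.
  apply: (IHm p) => //.
    move/eqP: px; rewrite k0 (raddf0 iota) addr0 mulf_eq0 (negbTE nzx) orbF.
    by rewrite rootE.
  by move: ltm; rewrite k0 polyC0 addr0 size_mulX.
suff -> : x^-1 = - ((map_poly iota p).[x] * iota k^-1).
  rewrite rpredN rpredM ?KS // horner_poly rpred_sum // => i _.
  by rewrite rpredM ?KS ?rpredX.
apply: (mulIf nzx); rewrite mulVf // mulNr mulrAC -mulNr.
have -> : - ((map_poly iota p).[x] * x) = iota k by apply/eqP;
  rewrite eq_sym -addr_eq0 addrC px.
by rewrite -rmorphM mulfV ?rmorph1.
Qed.

(** E[a] is spanned by the x * a ^+ i with x in a spanning sequence of E and i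
    smaller than the degree of a polynomial killing a; it is a field by
    [algebraic_inv_closed]. *)
Lemma finite_extension_adjoin (E : {pred C}) a : finite_extension iota E ->
  exists E', [/\ finite_extension iota E', {subset E <= E'} & a \in E'].
Proof.
move=> [divE KE [s spanE]].
pose E0 : divringClosed C := HB.pack E (GRing.isDivringClosed.Build C E divE).
pose E' : {pred C} := fun x =>
  `[< exists2 q : {poly C}, q \is a polyOver E0 & x = q.[a] >].
have ringE' : subring_closed E'.
  split.
  - by apply/asboolP; exists 1; rewrite ?rpred1 // hornerE.
  - move=> _ _ /asboolP[p Ep ->] /asboolP[q Eq ->]; apply/asboolP.
    by exists (p - q); rewrite ?rpredB // !hornerE.
  - move=> _ _ /asboolP[p Ep ->] /asboolP[q Eq ->]; apply/asboolP.
    by exists (p * q); rewrite ?rpredM // !hornerE.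
pose S : subringClosed C := HB.pack E' (GRing.isSubringClosed.Build C E'
  ringE').
have EE' : {subset E <= E'}.
  by move=> x Ex; apply/asboolP; exists x%:P; rewrite ?polyOverC // hornerE.
have KE' k : iota k \in S by apply: EE'.
have invE' : {in S, forall x, x^-1 \in S} := algebraic_inv_closed KE'.
exists E'; split=> //; last first.
  by apply/asboolP; exists 'X; rewrite ?polyOverX // hornerE.
split=> //.
  split; first exact: (rpred1 S).
    by move=> x y; exact: (@rpredB _ S).
  by move=> x y Ex Ey; apply: (@rpredM _ S) => //; exact: invE'.
have [p nzp pa] := algC a.
pose d := (size p).-1; pose s' := [seq x * a ^+ i | x <- s, i <- seq.iota 0 d].
have gens x i : x \in s -> (i < d)%N -> lin_span s' (x * a ^+ i).
  by move=> sx lt; apply: lin_span_mem; apply: allpairs_f; rewrite ?mem_iota.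
have szp : size p = d.+1 by rewrite prednK // lt0n size_poly_eq0.
(* the relation that reduces the powers of a *)
have ad : a ^+ d = \sum_(i < d) iota (- p`_i / lead_coef p) * a ^+ i.
  have nzl : iota (lead_coef p) != 0 by rewrite fmorph_eq0 lead_coef_eq0.
  apply: (mulfI nzl); move: pa; rewrite rootE horner_poly szp big_ord_recr /=.
  rewrite -[p`_d]/(lead_coef p) addrC addr_eq0 => /eqP ->.
  rewrite mulr_sumr -sumrN; apply: eq_bigr => i _.
  by rewrite mulrA -rmorphM [lead_coef p * _]mulrC divfK ?lead_coef_eq0 //
    rmorphN mulNr.
have spanM x : lin_span s' x -> lin_span s' (x * a).
  move=> [c ->]; rewrite mulr_suml; apply: lin_span_sum => i.
  rewrite -mulrA; apply: lin_spanZ.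
  have /allpairsP[[y j] /= [sy jd ->]] : s'`_i \in s' by apply: mem_nth.
  rewrite mem_iota /= in jd; rewrite -mulrA -exprSr.
  have [lt|ge] := ltnP j.+1 d; first exact: gens.
  have -> : j.+1 = d by apply/eqP; rewrite eqn_leq jd ge.
  rewrite ad mulr_sumr; apply: lin_span_sum => k.
  by rewrite mulrCA; apply: lin_spanZ; apply: gens.
exists s' => x /asboolP[q Eq ->]; rewrite horner_coef; apply: lin_span_sum => i.
have [c ->] := spanE _ (polyOverP Eq i); rewrite mulr_suml;
  apply: lin_span_sum => j.
rewrite -mulrA; apply: lin_spanZ.
elim: (i : nat) => [|k IHk]; last by rewrite exprSr mulrA; exact: spanM.
have [d0|d_gt0] := posnP d; last by apply: gens; rewrite ?mem_nth.
have := ad; rewrite d0 big_ord0 expr0 => /eqP; by rewrite oner_eq0.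
Qed.

Lemma finite_extension_base : exists E, finite_extension iota E.
Proof.
exists (fun x => `[< exists k, x = iota k >]); split.
- split; first by apply/asboolP; exists 1; rewrite rmorph1.
    by move=> _ _ /asboolP[x ->] /asboolP[y ->]; apply/asboolP;
      exists (x - y); rewrite rmorphB.
  by move=> _ _ /asboolP[x ->] /asboolP[y ->]; apply/asboolP; exists (x / y);
    rewrite fmorph_div.
- by move=> k; apply/asboolP; exists k.
exists [:: 1] => _ /asboolP[k ->]; exists (fun=> k).
by rewrite big_ord_recl big_ord0 /= mulr1 addr0.
Qed.

Lemma finite_extension_compositum E1 E2 :
  finite_extension iota E1 -> finite_extension iota E2 ->
  exists E, [/\ finite_extension iota E, {subset E1 <= E} & {subset E2 <= E}].
Proof.
move=> fE1 [_ _ [s span2]].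
have [E [fE E1E sE]] : exists E, [/\ finite_extension iota E,
  {subset E1 <= E} & {subset s <= E}].
  elim: s {span2} => [|a s [E [fE E1E sE]]]; first by exists E1; split=> // x.
  have [E' [fE' EE' aE']] := finite_extension_adjoin a fE.
  exists E'; split=> // x; first by move=> /E1E; exact: EE'.
  by rewrite inE => /predU1P[->|/sE] //; exact: EE'.
exists E; split=> // x /span2[c ->]; have [divE KE _] := fE.
pose E0 : divringClosed C := HB.pack E (GRing.isDivringClosed.Build C E divE).
apply: (@rpred_sum _ E0) => i _; apply: (@rpredM _ E0); first exact: KE.
by apply: sE; apply: mem_nth.
Qed.

Lemma admissible_common (T1 T2 : topologicalType) (f : T1 -> C) (g : T2 -> C) :
  admissible iota f -> admissible iota g ->
  exists E, [/\ finite_extension iota E, forall t, f t \in E &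
    forall t, g t \in E].
Proof.
move=> [_ [E1 [fE1 fE]]] [_ [E2 [fE2 gE]]].
have [E [fE' E1E E2E]] := finite_extension_compositum fE1 fE2.
by exists E; split=> // t; [apply: E1E | apply: E2E].
Qed.
End FiniteExtensions.

Section AdmissibleFunctions.
Variables (l : nat) (K : fieldType) (C : topClosedFieldType).
Variable iota : {rmorphism K -> C}.
Hypothesis hC : is_Ql_closure l iota.

(** A multiple of 1 that vanishes has valuation +oo, whereas positive integers
    have finite valuation. *)
Lemma pchar_closure : [pchar C] =i pred0.
Proof.
have [vK [v [[[vK0 _ _ _] vKn _ _] _ _ _ _]]] := hC.
apply/pcharf0P => n; rewrite -(rmorph_nat iota) fmorph_eq0.
case: n => [|n]; first by rewrite !eqxx.
apply/negbTE/eqP => e; have := vKn n.+1 isT.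
by have /vK0 -> := e.
Qed.

Let algC : forall x : C, algebraicOver iota x.
Proof. by have [vK [v [_ a _ _ _]]] := hC. Qed.

Lemma admissibleD (T : topologicalType) (f g : T -> C) :
  admissible iota f -> admissible iota g ->
  admissible iota (fun t => f t + g t).
Proof.
move=> af ag; have [E [fE fEt gEt]] := admissible_common algC af ag.
have [vK [v [_ _ vv _ nv]]] := hC.
split; first by apply: (continuous_add vv nv); [case: af | case: ag].
exists E; split=> // t; have [divE _ _] := fE.
pose E0 : divringClosed C := HB.pack E (GRing.isDivringClosed.Build C E divE).
exact: (@rpredD _ E0).
Qed.

Lemma admissibleM (T : topologicalType) (f g : T -> C) :
  admissible iota f -> admissible iota g ->
  admissible iota (fun t => f t * g t).
Proof.
move=> af ag; have [E [fE fEt gEt]] := admissible_common algC af ag.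
have [vK [v [_ _ vv _ nv]]] := hC.
split; first by apply: (continuous_mul vv nv); [case: af | case: ag].
exists E; split=> // t; have [divE _ _] := fE.
pose E0 : divringClosed C := HB.pack E (GRing.isDivringClosed.Build C E divE).
exact: (@rpredM _ E0).
Qed.

Lemma admissible_cst (T : topologicalType) (a : C) :
  admissible iota (fun _ : T => a).
Proof.
split; first exact: cst_continuous.
have [E0 fE0] := finite_extension_base iota.
by have [E [fE _ aE]] := finite_extension_adjoin algC a fE0; exists E.
Qed.

Lemma admissible_sum (T : topologicalType) (I : Type) (r : seq I)
    (f : I -> T -> C) :
  (forall i, admissible iota (f i)) ->
  admissible iota (fun t => \sum_(i <- r) f i t).
Proof.
move=> af; elim: r => [|i r IHr].
  under eq_fun do rewrite big_nil; exact: admissible_cst.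
under eq_fun do rewrite big_cons; exact: admissibleD.
Qed.

Lemma admissible_comp (T T' : topologicalType) (h : T' -> T) (f : T -> C) :
  continuous h -> admissible iota f -> admissible iota (fun t => f (h t)).
Proof.
move=> ch [cf [E [fE fEt]]]; split; last by exists E.
by move=> t; apply: (@continuous_comp _ _ _ h f t (ch t) (cf (h t))).
Qed.

Lemma admissible_indicator (T : topologicalType) (P : T -> bool) :
  open [set t | P t] -> open [set t | ~~ P t] ->
  admissible iota (fun t => (P t)%:R).
Proof.
move=> oP oNP; split.
  move=> t A /nbhs_singleton At; rewrite /nbhs/= /filter.nbhs /=.
  have [Pt|NPt] := boolP (P t).
    have nP : nbhs t [set t | P t] by apply: open_nbhs_nbhs; split.
    by apply: filterS nP => u /= Pu; move: At; rewrite Pt Pu.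
  have nP : nbhs t [set t | ~~ P t] by apply: open_nbhs_nbhs; split.
  by apply: filterS nP => u /= /negbTE Pu; move: At; rewrite (negbTE NPt) Pu.
have [E fE] := finite_extension_base iota; exists E; split=> // t.
by have [_ KE _] := fE; rewrite -(rmorph_nat iota).
Qed.

Lemma admissible_family (T : topologicalType) (I : finType) (f : I -> T -> C) :
  (forall i, admissible iota (f i)) ->
  exists2 E, finite_extension iota E & forall i t, f i t \in E.
Proof.
move=> af; suff [E fE fEt] : exists2 E, finite_extension iota E &
    forall i, i \in enum I -> forall t, f i t \in E.
  by exists E => // i; apply: fEt; rewrite mem_enum.
elim: (enum I) => [|i s [E fE sE]]; first by have [E fE] :=
  finite_extension_base iota; exists E.
have [_ [E1 [fE1 iE1]]] := af i.
have [E' [fE' EE' E1E']] := finite_extension_compositum algC fE fE1.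
exists E' => // j; rewrite inE => /predU1P[-> t|/sE js t]; first exact: E1E'.
exact: EE'.
Qed.

End AdmissibleFunctions.

(** * Representations in terms of matrices *)

Section MatrixRepresentations.
Variables (l : nat) (K : fieldType) (C : topClosedFieldType).
Variable iota : {rmorphism K -> C}.
Hypothesis hC : is_Ql_closure l iota.
Variables (G : topGroupType) (mu : G -> G -> C).
Hypothesis hmu : admissible_multiplier iota mu.

(** Matrices act on columns, so that R is multiplicative up to mu; the
    corresponding endomorphism of the space of rows is [col_act]. *)
Record matrix_rep n (R : G -> 'M[C]_n) : Prop := MatrixRep {
  matrix_repM : forall x y, R x *m R y = mu x y *: R (x * y)%g;
  matrix_rep_unit : forall x, R x \in unitmx;
  matrix_rep_adm : forall i j, admissible iota (fun x => R x i j)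
}.

(** Finiteness of the projective image, in a form that is inherited by sums,
    summands and conjugates. *)
Definition finite_mod_scalars n (R : G -> 'M[C]_n) : Prop :=
  exists (F : finType) (p : G -> F), forall x y, p x = p y ->
    exists2 c, c != 0 & R x = c *: R y.

Definition col_act n (A : 'M[C]_n) : 'End('rV[C]_n) := linfun (mulmxr A^T).

Lemma col_actE n (A : 'M[C]_n) v : col_act A v = v *m A^T.
Proof. by rewrite lfunE. Qed.

Lemma mu_neq0 x y : mu x y != 0.
Proof. by case: hmu. Qed.

Lemma matrix_rep1 n (R : G -> 'M[C]_n) : matrix_rep R -> R 1%g = 1%:M.
Proof.
move=> rR; have := matrix_repM rR 1%g 1%g; have [_ _ -> _] := hmu.
rewrite mulg1 scale1r => /(canRL (mulmxK (matrix_rep_unit rR 1%g))).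
by rewrite mulmxV // matrix_rep_unit.
Qed.

Lemma col_actM n (R : G -> 'M[C]_n) : matrix_rep R -> forall x y,
  (col_act (R x) \o col_act (R y))%VF = mu x y *: col_act (R (x * y)%g).
Proof.
move=> rR x y; apply/lfunP => v; rewrite comp_lfunE scale_lfunE !col_actE.
by rewrite -mulmxA -trmx_mul (matrix_repM rR) linearZ /= -scalemxAr.
Qed.

(** In any basis b the coordinates of the action are linear combinations of the
    entries of R, hence admissible, with values in a common finite extension E.
    If E also contains the values of mu, the E-form is mapped onto itself since
    the inverse of R x is proportional, over E, to R x^-1. *)
Lemma col_act_admissible n (R : G -> 'M[C]_n) : matrix_rep R ->
  admissible_aut iota (fun x => col_act (R x)).
Proof.
move=> rR; split.
  move=> x; apply/lker0P => u v; rewrite !col_actE.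
  by apply: (can_inj (mulmxK _)); rewrite unitmx_tr matrix_rep_unit.
pose b := vbasis {: 'rV[C]_n}.
have bP : basis_of {:'rV[C]_n} b := vbasisP _.
pose a i (j : nat) x := coord b i (col_act (R x) b`_j).
have adm_a i j : admissible iota (a i j).
  have -> : a i j = fun x =>
      \sum_k \sum_m (b`_j) 0 m * coord b i (delta_mx 0 k) * R x k m.
    apply/funext => x; rewrite /a col_actE [in LHS](row_sum_delta (b`_j *m _)).
    rewrite linear_sum /=; apply: eq_bigr => k _;
      rewrite linearZ /= mxE mulr_suml.
    by apply: eq_bigr => m _; rewrite mxE mulrAC.
  apply: (admissible_sum hC) => k; apply: (admissible_sum hC) => m.
  by apply: (admissibleM hC); [apply: (admissible_cst hC) | apply:
    matrix_rep_adm].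
have [E1 fE1 aE1] := admissible_family hC
  (fun ij : 'I_(\dim {: 'rV[C]_n}) * 'I_(\dim {: 'rV[C]_n}) => adm_a ij.1 ij.2).
have [[_ [E2 [fE2 muE2]]] _ mu1 _] := hmu.
have algC : forall x : C, algebraicOver iota x by have [vK [v [_ ? _ _ _]]] :=
  hC.
have [E [fE E1E E2E]] := finite_extension_compositum algC fE1 fE2.
have aE i (j : 'I_(\dim {: 'rV[C]_n})) x : a i j x \in E by apply: E1E;
  apply: (aE1 (i, j)).
have muE x y : mu x y \in E by apply: E2E; apply: (muE2 (x, y)).
exists E, b; split=> // [x|i j]; last by case: (adm_a i j).
have [divE _ _] := fE.
pose E0 : divringClosed C := HB.pack E (GRing.isDivringClosed.Build C E divE).
have stE y u : E_form E b u -> E_form E b (col_act (R y) u).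
  move=> Eu i; rewrite (coord_basis bP (memvf u)) linear_sum linear_sum /=.
  apply: (@rpred_sum _ E0) => j _; rewrite linearZ linearZ /=.
  by apply: (@rpredM _ E0); [exact: Eu | exact: aE].
apply/seteqP; split=> [_ [u Eu <-]|u Eu]; first exact: stE.
exists ((mu x x^-1%g)^-1 *: col_act (R x^-1%g) u).
  move=> i; rewrite linearZ /=; apply: (@rpredM _ E0); last exact: stE.
  by rewrite (@rpredV _ E0).
rewrite linearZ /= -comp_lfunE (col_actM rR) mulgV matrix_rep1 // scale_lfunE
  col_actE.
by rewrite trmx1 mulmx1 scalerA mulVf ?scale1r ?mu_neq0.
Qed.

Definition matrix_adm_rep n (R : G -> 'M[C]_n) (rR : matrix_rep R) :
  adm_rep iota mu :=
  AdmRep (col_act_admissible rR) (col_actM rR).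

Lemma matrix_rep_finite n (R : G -> 'M[C]_n) (rR : matrix_rep R) :
  finite_mod_scalars R -> finite_projective_image (matrix_adm_rep rR).
Proof.
move=> [F [p pP]].
pose g (f : F) : set 'End('rV[C]_n) :=
  if pselect (exists x, p x = f) is left ex
  then proj_class (col_act (R (projT1 (cid ex)))) else set0.
apply: (@sub_finite_set _ _ (g @` setT)); last by apply: finite_image;
  exact: finite_finset.
move=> _ [x _ <-]; exists (p x) => //; rewrite /g.
case: pselect => [ex|[]]; last by exists x.
case: cid => y /= /pP[c nzc ->]; rewrite /proj_class.
have -> : col_act (c *: R x) = c *: col_act (R x).
  by apply/lfunP => v; rewrite scale_lfunE !col_actE linearZ /= -scalemxAr.
apply/seteqP; split=> f /= [d nzd ->]; [exists (d * c) | exists (d / c)].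
- by rewrite mulf_neq0.
- by rewrite scalerA.
- by rewrite mulf_neq0 ?invr_neq0.
- by rewrite scalerA divfK.
Qed.

Definition matrix_fin_rep n (R : G -> 'M[C]_n) (rR : matrix_rep R)
    (fR : finite_mod_scalars R) : fin_rep iota mu :=
  FinRep (matrix_rep_finite rR fR).

Definition rep_matrix (V : fin_rep iota mu) (x : G) : 'M[C]_(fin_rep_dim V) :=
  (lin1_mx (fin_rep_act V x))^T.

Lemma rep_matrixE (V : fin_rep iota mu) x u :
  fin_rep_act V x u = u *m (rep_matrix V x)^T.
Proof. by rewrite trmxK mul_rV_lin1. Qed.

(** The entries are linear combinations of the coordinates, in a basis of an
    E-form, of the images of that basis. These are admissible, being elements
    of E that depend continuously on x. *)
Lemma rep_matrixP (V : fin_rep iota mu) : matrix_rep (rep_matrix V).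
Proof.
split.
- move=> x y; apply: trmx_inj; rewrite trmx_mul linearZ /=.
  apply/row_matrixP => i; rewrite !rowE mulmxA -!rep_matrixE -comp_lfunE
    fin_rep_mul.
  by rewrite scale_lfunE rep_matrixE scalemxAr.
- move=> x; have [ker0 _] := fin_rep_admissible V;
  rewrite -unitmx_tr -row_free_unit.
  apply/inj_row_free => v; rewrite -rep_matrixE => e.
  by apply: (lker0P (ker0 x)); rewrite e linear0.
move=> i j; have [_ [E [b [fE bP stE cE]]]] := fin_rep_admissible V.
have [[E1 _ _] _ _] := fE.
have adm_a k (m : 'I_(\dim {: 'rV[C]_(fin_rep_dim V)})) :
      admissible iota (fun x => coord b k (fin_rep_act V x b`_m)).
  split; first exact: cE.
  exists E; split=> // x; have : E_form E b (fin_rep_act V x b`_m).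
    rewrite -(stE x); exists b`_m => // q.
    rewrite coord_free ?(basis_free bP) // -(rmorph_nat iota).
    by case: fE => _ KE _; exact: KE.
  by apply.
have -> : (fun x => rep_matrix V x i j) = fun x =>
   \sum_m \sum_(k < \dim {: 'rV[C]_(fin_rep_dim V)}) coord b m (delta_mx 0 j) *
     (b`_k) 0 i * coord b k (fin_rep_act V x b`_m).
  apply/funext => x.
  have -> : rep_matrix V x i j = (fin_rep_act V x (delta_mx 0 j)) 0 i.
    by rewrite rep_matrixE -rowE !mxE.
  rewrite {1}(coord_basis bP (memvf (delta_mx 0 j))) linear_sum summxE /=.
  apply: eq_bigr => m _; rewrite linearZ /= mxE [in LHS](coord_basis bP (memvf
    (fin_rep_act V x b`_m))).
  rewrite summxE mulr_sumr; apply: eq_bigr => k _; rewrite mxE.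
  by rewrite -mulrA; congr (_ * _); rewrite mulrC.
apply: (admissible_sum hC) => m; apply: (admissible_sum hC) => k.
by apply: (admissibleM hC) => //; apply: (admissible_cst hC).
Qed.

Lemma rep_matrix_finite (V : fin_rep iota mu) :
  finite_mod_scalars (rep_matrix V).
Proof.
have /finite_seqP[s es] := fin_rep_finite V.
have in_s x : proj_class (fin_rep_act V x) \in s.
  suff : [set` s] (proj_class (fin_rep_act V x)) by [].
  by rewrite -es; exists x.
exists (seq_sub s), (fun x => SeqSub (in_s x)) => x y /(congr1 val) /= e.
have : proj_class (fin_rep_act V y) (fin_rep_act V x).
  by rewrite -e; exists 1; rewrite ?oner_neq0 // scale1r.
move=> [c nzc exy]; exists c => //.
apply: trmx_inj; apply/row_matrixP => i.
by rewrite linearZ /= !rowE -scalemxAr -!rep_matrixE exy scale_lfunE.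
Qed.

End MatrixRepresentations.

(** * Relations in the Grothendieck group *)

Section Quotients.
Variables (M : zmodType) (S : set M).

Lemma gen_sub y : S y -> y \in gen S.
Proof. by move=> Sy; apply/asboolP => N; apply. Qed.

(** The universal property of the quotient by a generated subgroup. *)
Lemma quot_gen_lift (N : zmodType) (f : {additive M -> N}) :
  (forall y, S y -> f y = 0) ->
  exists phi : {additive Quotient.quot (gen S) -> N},
    forall y, phi (\pi_(Quotient.quot (gen S)) y) = f y.
Proof.
move=> f0; pose ker : {pred M} := fun y => f y == 0.
have ker_closed : zmod_closed ker.
  split; first by rewrite unfold_in raddf0.
  by move=> x y /eqP fx /eqP fy; rewrite unfold_in raddfB /= fx fy subrr.
(* a subgroup containing S, hence containing gen S *)
pose kerZ : zmodClosed M := HB.pack ker (GRing.isZmodClosed.Build M ker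
  ker_closed).
have kerS y : y \in gen S -> f y = 0.
  by move=> /asboolP/(_ kerZ) => h; apply/eqP; apply: h => z /f0 e; apply/eqP.
pose phi (q : Quotient.quot (gen S)) := f (generic_quotient.repr q).
have phiE y : phi (\pi_(Quotient.quot (gen S)) y) = f y.
  apply/eqP; rewrite -subr_eq0 -raddfB; apply/eqP/kerS.
  by rewrite Quotient.idealrBE generic_quotient.reprK.
have phi_additive : zmod_morphism phi.
  by move=> x y; rewrite -[x]generic_quotient.reprK -[y]generic_quotient.reprK
    -raddfB !phiE raddfB.
pose phiA : {additive Quotient.quot (gen S) -> N} :=
  HB.pack phi (GRing.isZmodMorphism.Build _ _ phi phi_additive).
by exists phiA.
Qed.
End Quotients.

Section K0Relations.
Variables (l : nat) (K : fieldType) (C : topClosedFieldType).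
Variable iota : {rmorphism K -> C}.
Hypothesis hC : is_Ql_closure l iota.
Variables (G : topGroupType) (mu : G -> G -> C).
Hypothesis hmu : admissible_multiplier iota mu.

Lemma K0class_extension (V' V V'' : fin_rep iota mu) :
  extension V' V V'' -> K0class V = K0class V' + K0class V''.
Proof.
move=> ext; rewrite /K0class -raddfD; apply/eqP; rewrite -Quotient.idealrBE.
by apply: gen_sub; exists V', V, V''.
Qed.

Definition matrix_class n (R : G -> 'M[C]_n) (rR : matrix_rep iota mu R)
    (fR : finite_mod_scalars R) : K0fin iota mu :=
  K0class (matrix_fin_rep hC hmu rR fR).

(** T1 and S2 are the maps of an extension; S1 and T2 split it as vector spaces,
    which makes exactness a matter of matrix identities. *)
Lemma matrix_class_biproduct n n1 n2
    (R : G -> 'M[C]_n) (R1 : G -> 'M[C]_n1)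
    (R2 : G -> 'M[C]_n2) rR fR rR1 fR1 rR2 fR2
    (T1 : 'M_(n, n1)) (S1 : 'M_(n1, n)) (T2 : 'M_(n, n2)) (S2 : 'M_(n2, n)) :
  S1 *m T1 = 1%:M -> S2 *m T2 = 1%:M -> S2 *m T1 = 0 ->
  T1 *m S1 + T2 *m S2 = 1%:M ->
  (forall x, R x *m T1 = T1 *m R1 x) -> (forall x, S2 *m R x = R2 x *m S2) ->
  @matrix_class n R rR fR =
    @matrix_class n1 R1 rR1 fR1 + @matrix_class n2 R2 rR2 fR2.
Proof.
move=> ST1 ST2 S2T1 TS RT1 SR2; apply: K0class_extension.
pose f : 'Hom('rV[C]_n1, 'rV[C]_n) := linfun (mulmxr T1^T).
pose g : 'Hom('rV[C]_n, 'rV[C]_n2) := linfun (mulmxr S2^T).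
have fE u : f u = u *m T1^T by rewrite lfunE.
have gE u : g u = u *m S2^T by rewrite lfunE.
exists f, g; split.
- move=> x; apply/lfunP => u; rewrite !comp_lfunE /= !col_actE fE fE.
  by rewrite -!mulmxA -!trmx_mul RT1.
- move=> x; apply/lfunP => u; rewrite !comp_lfunE /= !col_actE gE gE.
  by rewrite -!mulmxA -!trmx_mul SR2.
- apply/lker0P => u v; rewrite !fE => e.
  by rewrite -[u]mulmx1 -[v]mulmx1 -trmx1 -ST1 trmx_mul !mulmxA e.
- apply/vspaceP => u; rewrite memv_ker gE; apply/memv_imgP/eqP => [[w _ ->]|u0].
    by rewrite fE -mulmxA -trmx_mul S2T1 trmx0 mulmx0.
  exists (u *m S1^T); rewrite ?memvf // fE -mulmxA -trmx_mul.
  rewrite -[LHS]mulmx1 -trmx1 -TS linearD /= mulmxDr [(T2 *m S2)^T]trmx_mul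
    mulmxA u0.
  by rewrite mul0mx addr0.
apply/vspaceP => u; rewrite memvf; apply/memv_imgP; exists (u *m T2^T);
  rewrite ?memvf //.
by rewrite gE -mulmxA -trmx_mul ST2 trmx1 mulmx1.
Qed.

(** A zero-dimensional representation is an extension of itself by itself. *)
Lemma matrix_class0 (R : G -> 'M[C]_0) rR fR : @matrix_class 0 R rR fR = 0.
Proof.
have := @matrix_class_biproduct 0 0 0 R R R rR fR rR fR rR fR 0 0 0 0.
move=> /(_ _ _ _ _ _ _)/esym/eqP; rewrite -subr_eq0 addrK => h; apply/eqP;
  apply: h.
all: by move=> *; apply/matrixP => -[].
Qed.

Lemma matrix_rep_id0 : matrix_rep iota mu (fun=> 1%:M : 'M[C]_0).
Proof. by split=> [x y|x|[]] //; [apply/matrixP => -[] | exact: unitmx1]. Qed.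

Lemma finite_id0 : finite_mod_scalars (fun _ : G => 1%:M : 'M[C]_0).
Proof. by exists unit, (fun=> tt) => x y _; exists 1;
  rewrite ?oner_neq0 ?scale1r. Qed.

Lemma matrix_class_iso n n' (R : G -> 'M[C]_n) (R' : G -> 'M[C]_n')
    rR fR rR' fR' (T : 'M_(n, n')) (S : 'M_(n', n)) :
  S *m T = 1%:M -> T *m S = 1%:M -> (forall x, R x *m T = T *m R' x) ->
  @matrix_class n R rR fR = @matrix_class n' R' rR' fR'.
Proof.
move=> ST TS RT.
rewrite (@matrix_class_biproduct n n' 0 R R' _ rR fR rR' fR' matrix_rep_id0
  finite_id0 T S 0 0) //.
- by rewrite matrix_class0 addr0.
- by apply/matrixP => -[].
- by rewrite mul0mx.
- by rewrite mul0mx addr0.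
- by move=> x; rewrite mul0mx mulmx0.
Qed.

Lemma K0class_rep_matrix (V : fin_rep iota mu) :
  K0class V = matrix_class (rep_matrixP hC V) (rep_matrix_finite V).
Proof.
rewrite (K0class_extension (V' := matrix_fin_rep hC hmu (rep_matrixP hC V)
  (rep_matrix_finite V))
  (V'' := matrix_fin_rep hC hmu matrix_rep_id0 finite_id0)).
  by rewrite -/(matrix_class _ _) -/(matrix_class matrix_rep_id0 _)
    matrix_class0 addr0.
exists \1%VF, 0; split.
- by move=> x; apply/lfunP => u; rewrite !comp_lfunE /= !id_lfunE col_actE
  rep_matrixE.
- by move=> x; apply/lfunP => u; apply/matrixP => i [].
- by apply/lker0P => u v; rewrite !id_lfunE.
- by rewrite lim1g; apply/vspaceP => u; rewrite memvf memv_ker zero_lfunE eqxx.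
by apply/vspaceP => u; rewrite memvf (_ : u = 0) ?mem0v //; apply/matrixP =>
  i [].
Qed.
End K0Relations.

Section Constructions.
Variables (l : nat) (K : fieldType) (C : topClosedFieldType).
Variable iota : {rmorphism K -> C}.
Hypothesis hC : is_Ql_closure l iota.
Variables (G : topGroupType) (mu : G -> G -> C).
Hypothesis hmu : admissible_multiplier iota mu.

Lemma matrix_rep_of1 n (R : G -> 'M[C]_n) :
  (forall x y, R x *m R y = mu x y *: R (x * y)%g) -> R 1%g = 1%:M ->
  (forall i j, admissible iota (fun x => R x i j)) -> matrix_rep iota mu R.
Proof.
move=> RM R1 Radm; split=> // x.
have : R x *m ((mu x x^-1%g)^-1 *: R x^-1%g) = 1%:M.
  rewrite -scalemxAr RM mulgV R1 scalerA mulVf ?scale1r //.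
  by case: hmu.
by case/mulmx1_unit.
Qed.

Lemma admissible_mulmx n m p (A : 'M[C]_(m, n)) (B : 'M[C]_(n, p))
    (R : G -> 'M[C]_n) :
  (forall i j, admissible iota (fun x => R x i j)) ->
  forall i j, admissible iota (fun x => (A *m R x *m B) i j).
Proof.
move=> Radm i j.
have -> : (fun x => (A *m R x *m B) i j) = fun x =>
  \sum_k \sum_q A i q * R x q k * B k j.
  by apply/funext => x; rewrite mxE; apply: eq_bigr => k _;
    rewrite mxE mulr_suml.
apply: (admissible_sum hC) => k; apply: (admissible_sum hC) => q.
apply: (admissibleM hC); last exact: (admissible_cst hC).
by apply: (admissibleM hC) => //; exact: (admissible_cst hC).
Qed.

(** The columns of T span an invariant subspace, and S gives coordinates on it;
    conjugation by an invertible matrix is a special case. *)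
Lemma matrix_rep_summand n m (R : G -> 'M[C]_n)
    (T : 'M_(n, m)) (S : 'M_(m, n)) :
  matrix_rep iota mu R -> S *m T = 1%:M ->
  (forall x, R x *m T = T *m (S *m R x *m T)) ->
  matrix_rep iota mu (fun x => S *m R x *m T).
Proof.
move=> rR ST RT; apply: matrix_rep_of1 => [x y||].
- rewrite -[S *m R x *m T *m _]mulmxA -RT mulmxA -(mulmxA S) (matrix_repM rR).
  by rewrite -scalemxAr -scalemxAl.
- by rewrite (matrix_rep1 hmu rR) mulmx1.
exact: admissible_mulmx (matrix_rep_adm rR).
Qed.

Lemma finite_mod_mulmx n m (R : G -> 'M[C]_n) (T : 'M_(n, m)) (S : 'M_(m, n)) :
  finite_mod_scalars R -> finite_mod_scalars (fun x => S *m R x *m T).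
Proof.
move=> [F [p pP]]; exists F, p => x y /pP[c nzc ->]; exists c => //.
by rewrite -scalemxAr -scalemxAl.
Qed.

Section Tensor.
Variables (gT : finGroupType) (p : G -> gT).
Hypothesis pM : forall x y, p (x * y)%g = (p x * p y)%g.
Hypothesis p_open : forall g, open [set x | p x = g].
Variables (m : nat) (A : mx_representation C [set: gT]%SET m).
Variables (n : nat) (R : G -> 'M[C]_n).
Hypothesis rR : matrix_rep iota mu R.

Lemma pullback1 : p 1%g = 1%g.
Proof. by apply: (mulgI (p 1%g)); rewrite -pM !mulg1. Qed.

(** f \o p is a combination of the indicator functions of the fibres of p. *)
Lemma admissible_pullback (f : gT -> C) : admissible iota (fun x => f (p x)).
Proof.
have -> : (fun x => f (p x)) = fun x => \sum_g f g * (p x == g)%:R.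
  apply/funext => x; rewrite (bigD1 (p x)) //= eqxx mulr1 big1 ?addr0 // => g.
  by rewrite eq_sym => /negbTE ->; rewrite mulr0.
apply: (admissible_sum hC) => g; apply: (admissibleM hC);
  first exact: (admissible_cst hC).
apply: admissible_indicator.
  by rewrite (_ : [set x | p x == g] = [set x | p x = g]) //; apply/seteqP;
    split=> x /= /eqP.
rewrite (_ : [set x | p x != g] = \bigcup_(h in [set h | h != g]) [set x | p x
  = h]).
  by apply: bigcup_open => h _; exact: p_open.
by apply/seteqP; split=> [x /= px|x [h /= hg ->]] //; exists (p x).
Qed.

Lemma matrix_rep_tens : matrix_rep iota mu (fun x => A (p x) *t R x).
Proof.
apply: matrix_rep_of1 => [x y||i j].
- rewrite tensmx_mul -repr_mxM ?finset.in_setT // (matrix_repM rR) pM.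
  by apply/matrixP => i j; rewrite !mxE mulrCA.
- by rewrite pullback1 repr_mx1 (matrix_rep1 hmu rR) tensmx11.
under eq_fun do rewrite mxE.
apply: (admissibleM hC); last exact: matrix_rep_adm rR _ _.
exact: (admissible_pullback (fun g => A g _ _)).
Qed.

Lemma finite_mod_tens :
  (forall x y, p x = p y -> exists2 c, c != 0 & R x = c *: R y) ->
  finite_mod_scalars (fun x => A (p x) *t R x).
Proof.
move=> pR; exists gT, p => x y pxy; have [c nzc e] := pR x y pxy; exists c =>
  //.
by rewrite pxy e; apply/matrixP => i j; rewrite !mxE mulrCA.
Qed.
End Tensor.
End Constructions.

(** * Modules over the twisted group algebra *)

HB.instance Definition _ (R : ringType) (X : choiceType) (M : lmodType R)
    (f : X -> M) :=
  GRing.isZmodMorphism.Build {freeg X / R} M (fglift f) (lift_is_additive f).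

Section TwistedAlgebra.
Variables (K : fieldType) (C : topClosedFieldType) (iota : {rmorphism K -> C}).
Variables (G : topGroupType) (mu : G -> G -> C).

Lemma fglift_scale (X : choiceType) (M : lmodType C) (f : X -> M) k
    (D : {freeg X / C}) :
  fglift f (k *: D) = k *: fglift f D.
Proof.
elim/freeg_ind_dom0: D => [|c x D _ _ IHD];
  first by rewrite scaler0 raddf0 scaler0.
rewrite scalerDr !raddfD /= IHD; congr (_ + _).
have -> : k *: << c *g x >> = << (k * c) *g x >> :> {freeg X / C}.
  apply/eqP/freeg_eqP => y; by rewrite coeffZ !coeffU mulrA.
by rewrite !liftU scalerA.
Qed.

Lemma freeg_ind_add (R : ringType) (X : choiceType)
    (P : {freeg X / R} -> Prop) :
  P 0 -> (forall a b, P a -> P b -> P (a + b)) ->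
  (forall k x, P << k *g x >>) ->
  forall D, P D.
Proof. by move=> P0 PD PU; elim/freeg_ind_dom0 => // k x D _ _ PDD; apply: PD.
Qed.

Lemma twalg_actDl (V : adm_rep iota mu) a b (v : V) :
  twalg_act (a + b) v = twalg_act a v + twalg_act b v.
Proof. exact: raddfD. Qed.

Lemma twalg_actU (V : adm_rep iota mu) k x (v : V) :
  twalg_act << k *g x >> v = k *: rep_act V x v.
Proof. exact: liftU. Qed.

Lemma twalg_actDr (V : adm_rep iota mu) a (v w : V) :
  twalg_act a (v + w) = twalg_act a v + twalg_act a w.
Proof.
elim/freeg_ind_add: a => [|a b IHa IHb|k x];
  first by rewrite /twalg_act !raddf0 addr0.
  by rewrite !twalg_actDl IHa IHb addrACA.
by rewrite !twalg_actU linearD scalerDr.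
Qed.

Lemma twalg_act_mul (V : adm_rep iota mu) a b (v : V) :
  twalg_act (twalg_mul mu a b) v = twalg_act a (twalg_act b v).
Proof.
elim/freeg_ind_add: a => [|a a' IHa IHa'|k x].
- by rewrite /twalg_mul /twalg_act !raddf0.
- by rewrite [twalg_mul _ _ _]raddfD !twalg_actDl IHa IHa'.
rewrite /twalg_mul liftU; elim/freeg_ind_add: b => [|b b' IHb IHb'|c y].
- by rewrite !raddf0 /twalg_act /= !raddf0 liftU linear0 scaler0.
- by rewrite raddfD scalerDr !twalg_actDl IHb IHb' twalg_actDr.
rewrite liftU /twalg_act !fglift_scale !liftU scale1r.
by rewrite [in RHS]linearZ /= -comp_lfunE rep_mul scale_lfunE !scalerA.
Qed.

End TwistedAlgebra.

(** * Monomial representations *)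

Section InducedLine.
Variables (l : nat) (K : fieldType) (C : topClosedFieldType).
Variable iota : {rmorphism K -> C}.
Hypothesis hC : is_Ql_closure l iota.
Variables (G : topGroupType) (mu : G -> G -> C).
Hypothesis hmu : admissible_multiplier iota mu.
Variables (n : nat) (R : G -> 'M[C]_n) (rR : matrix_rep iota mu R).
Hypothesis fR : finite_mod_scalars R.
Variable o : 'I_n.
Hypothesis mono : forall x i j j', R x j i != 0 -> R x j' i != 0 -> j = j'.

Let e i : 'rV[C]_n := delta_mx 0 i.

Let act_e x i j : R x j i != 0 -> e i *m (R x)^T = R x j i *: e j.
Proof.
move=> nz; apply/rowP => k; rewrite -rowE !mxE eqxx /=.
have [->|ne] := eqVneq k j; first by rewrite mulr1.
by rewrite mulr0; apply/eqP; apply: contraNT ne => /mono/(_ nz) ->.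
Qed.

Let muN0 x y : mu x y != 0. Proof. by case: hmu. Qed.

Let entry0 x i j j' : R x j i != 0 -> j' != j -> R x j' i = 0.
Proof. by move=> nz ne; apply/eqP; apply: contraNT ne => /mono/(_ nz) ->. Qed.

Let entryM x y i j k : R y j i != 0 ->
  R (x * y)%g k i = (mu x y)^-1 * (R x k j * R y j i).
Proof.
move=> yji; have := congr1 (fun M : 'M_n => M k i) (matrix_repM rR x y).
rewrite !mxE (bigD1 j) //= big1 ?addr0 => [->|q /(entry0 yji) ->];
  last by rewrite mulr0.
by rewrite mulrA mulVf ?mul1r.
Qed.

Let entry1 i : R 1%g i i = 1.
Proof. by rewrite (matrix_rep1 hmu rR) mxE eqxx. Qed.

Let entryV x i j : R x j i != 0 -> R x^-1%g i j != 0.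
Proof.
move=> nz; have := entryM x^-1%g i nz; rewrite mulVg entry1 => h.
by apply: contra_eq_neq h => ->; rewrite mul0r mulr0 oner_neq0.
Qed.

(** As R x is monomial, this is the stabiliser of the line of index o. *)
Let line : {pred G} := fun x => R x o o != 0.

Let line_closed : group_closed line.
Proof.
split; first by rewrite unfold_in entry1 oner_neq0.
move=> x y xH yH; rewrite unfold_in (entryM _ _ (entryV yH)).
by rewrite !mulf_neq0 ?invr_neq0 // entryV.
Qed.

Let lineV : invg_closed line. Proof. exact: group_closedV line_closed. Qed.
Let lineM : mulg_closed line. Proof. exact: group_closedM line_closed. Qed.

Let H : groupClosed G := HB.pack line (monoid.isMulClosed.Build G line lineM)
  (monoid.isMul1Closed.Build G line line_closed.1) (monoid.isInvClosed.Build G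
    line lineV).

Definition line_orbit : {set 'I_n} := [set j |
  `[< exists x, R x j o != 0 >]]%SET.

Lemma mem_line_orbit : o \in line_orbit.
Proof. by rewrite finset.in_set; apply/asboolP; exists 1%g;
  rewrite entry1 oner_neq0. Qed.

Lemma line_orbit_closed x i j :
  R x j i != 0 -> (i \in line_orbit) = (j \in line_orbit).
Proof.
have closed y k m : R y m k != 0 -> k \in line_orbit -> m \in line_orbit.
  move=> ymk; rewrite !finset.in_set => /asboolP[z zk]; apply/asboolP;
    exists (y * z)%g.
  by rewrite (entryM _ _ zk) !mulf_neq0 ?invr_neq0.
move=> xji; apply/idP/idP; first exact: closed xji.
by apply: closed; exact: entryV xji.
Qed.

Hypothesis trans : forall i, exists x, R x i o != 0.

Let idx_ex x : exists j, R x j o != 0.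
Proof.
apply/existsP; rewrite -[X in is_true X]negbK negb_exists; apply/negP =>
  /forallP z.
have := congr1 (fun M : 'M_n => M o o) (matrix_repM rR x^-1%g x).
rewrite mulVg !mxE entry1 mulr1 big1 => [/eqP|k _];
  first by rewrite eq_sym (negbTE (muN0 _ _)).
by have := z k; rewrite negbK => /eqP ->; rewrite mulr0.
Qed.

Let entryVE x i j : (R x^-1%g i j != 0) = (R x j i != 0).
Proof. by apply/idP/idP => /entryV; rewrite ?invgK. Qed.

Let H_open : open [set` H].
Proof.
have [vK [v [_ _ vv _ nv]]] := hC.
have -> : [set` H] = (fun x => R x o o) @^-1` [set c | c != 0] by [].
apply: open_comp; last exact: neq0_open vv nv.
by move=> x _; have [c _] := matrix_rep_adm rR o o; exact: c.
Qed.

Let H_index : finite_index H.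
Proof.
apply: (@sub_finite_set _ _ ((fun i => [set y : G | R y i o != 0]) @` setT));
  last first.
  by apply: finite_image; exact: finite_finset.
move=> _ [x _ <-]; have [j xj] := idx_ex x; exists j => //; apply/seteqP;
  split=> y /=.
  move=> yj; rewrite unfold_in /line (entryM _ _ yj) !mulf_neq0 ?invr_neq0 //.
  by rewrite entryVE.
have [k yk] := idx_ex y; rewrite unfold_in /line (entryM _ _ yk)
  !mulf_eq0 !negb_or.
by case/and3P=> _; rewrite entryVE => /(mono xj) ->.
Qed.

Let valH (h : subgroup H) : R (val h) o o != 0.
Proof. by have := valP h; rewrite !inE. Qed.

Let RH (h : subgroup H) : 'M[C]_1 := (R (val h) o o)%:M.

Let val_cts : continuous (val : subgroup H -> G).
Proof. exact: (@initial_continuous (subgroup H) G set_val). Qed.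

Let hmuH : admissible_multiplier iota (@restrict_mul C G mu H).
Proof.
have [amu mu0 mu1 muA] := hmu; split; last by move=> x y z; exact: muA.
  2: by move=> x y; exact: mu0.
  2: exact: mu1.
apply: (admissible_comp (h := fun p : subgroup H * subgroup H =>
  (val p.1, val p.2)) _ amu).
move=> -[x y]; apply: cvg_pair => /=.
  by apply: (cvg_comp fst val); [exact: cvg_fst | exact: val_cts].
by apply: (cvg_comp snd val); [exact: cvg_snd | exact: val_cts].
Qed.

Let rRH : matrix_rep iota (@restrict_mul C G mu H) RH.
Proof.
apply: (matrix_rep_of1 hmuH) => [x y||i j].
- have yH : R (val y) o o != 0 by exact: valH.
  rewrite /RH -scalar_mxM scale_scalar_mx [val (x * y)%g]/(val x * val y)%g.
  by rewrite (entryM _ _ yH) /restrict_mul mulrA mulfV ?mul1r.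
- by rewrite /RH [val _]/(1%g : G) entry1.
rewrite !ord1; under eq_fun do rewrite mxE eqxx mulr1n.
exact: (admissible_comp val_cts (matrix_rep_adm rR o o)).
Qed.

Let V : adm_rep iota (@restrict_mul C G mu H) := matrix_adm_rep hC hmuH rRH.
Let W : adm_rep iota mu := matrix_adm_rep hC hmu rR.

Let embed (v : V) : W := (v : 'rV[C]_1) 0 0 *: e o.

Let embed_act h v : rep_act W (val h) (embed v) = embed (rep_act V h v).
Proof.
rewrite /= !col_actE /embed -scalemxAl (act_e (valH h)) scalerA.
by rewrite /RH tr_scalar_mx mul_mx_scalar mxE mulrC.
Qed.

Let embedD u v : embed (u + v) = embed u + embed v.
Proof. by rewrite /embed mxE scalerDl. Qed.

Let embedZ k v : embed (k *: v) = k *: embed v.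
Proof. by rewrite /embed mxE scalerA. Qed.

Let tensorE (a : {freeg G / C}) (v : V) :
  tensor a v = \pi_(Quotient.quot (gen (tensor_rel (V := V)))) << (a, v) >>.
Proof. by []. Qed.

Let tensorDl (a a' : {freeg G / C}) (v : V) :
  tensor (a + a') v = tensor a v + tensor a' v.
Proof.
rewrite !tensorE -raddfD; apply/eqP; rewrite -Quotient.idealrBE; apply: gen_sub.
by left; left; exists a, a', v.
Qed.

Let tensorDr (a : {freeg G / C}) (v v' : V) :
  tensor a (v + v') = tensor a v + tensor a v'.
Proof.
rewrite !tensorE -raddfD; apply/eqP; rewrite -Quotient.idealrBE; apply: gen_sub.
by left; right; exists a, v, v'.
Qed.

Let tensorM (a : {freeg G / C}) (b : {freeg (subgroup H) / C}) (v : V) :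
  tensor (twalg_mul mu a (twalg_incl b)) v = tensor a (twalg_act b v).
Proof.
rewrite !tensorE; apply/eqP; rewrite -Quotient.idealrBE; apply: gen_sub.
by right; exists a, b, v.
Qed.

Let tensorU k x h (v : V) :
  tensor << k *g (x * val h)%g >> v =
  tensor << x >> ((k / mu x (val h)) *: rep_act V h v).
Proof.
rewrite -twalg_actU -tensorM; congr tensor.
rewrite /twalg_mul liftU scale1r /twalg_incl liftU fglift_scale liftU.
rewrite scale1r scalerA divfK // -[RHS]/(k *: << _ >>).
by apply/eqP/freeg_eqP => y; rewrite coeffZ !coeffU mul1r.
Qed.

(** With elements g_ i of G carrying the line o to the line i, the inverse of
    a (x) v |-> a v sends the i-th basis vector to a multiple of g_ i (x) 1. It
    is an inverse because an x in G carrying o to j is g_ j times an element of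
    H, which can be moved across the tensor sign. *)
Lemma is_Ind_line : is_Ind V W.
Proof.
pose g0 (z : ({freeg G / C} * V)%type) : zmodule (rep_space W) :=
  @twalg_act K C iota G mu W z.1 (embed z.2).
pose f0 (D : {freeg ({freeg G / C} * V)%type}) : rep_space W := fglift g0 D.
have f0_add : zmod_morphism f0 by move=> x y; exact: (lift_is_additive g0 x y).
pose f0A : {additive {freeg ({freeg G / C} * V)%type} -> W} :=
  HB.pack f0 (GRing.isZmodMorphism.Build _ _ f0 f0_add).
have f0U z : f0A << z >> = twalg_act z.1 (embed z.2).
  by rewrite /= /f0 liftU scale1r.
have embed_mul b v : twalg_act (twalg_incl b) (embed v) = embed (twalg_act b v).
  elim/freeg_ind_add: b => [|b b' IHb IHb'|k h].
  - by rewrite /twalg_incl /twalg_act !raddf0 /embed mxE scale0r.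
  - by rewrite /twalg_incl raddfD !twalg_actDl embedD; congr (_ + _).
  rewrite /twalg_incl liftU /twalg_act fglift_scale !liftU scale1r embedZ.
  by congr (_ *: _); exact: embed_act.
have rel0 r : tensor_rel (V := V) r -> f0A r = 0.
  case=> [[|]|] [a [b [v ->]]]; rewrite raddfB ?raddfD !f0U /=.
  - by rewrite -opprD twalg_actDl subrr.
  - by rewrite -opprD embedD twalg_actDr subrr.
  by rewrite twalg_act_mul embed_mul subrr.
have [phi phiE] := quot_gen_lift rel0.
have phiT a v : phi (tensor a v) = twalg_act a (embed v)
  by rewrite tensorE phiE f0U.
exists phi; split; last first.
  by move=> a b v; rewrite !phiT; exact: twalg_act_mul.
have /fin_all_exists[g_ gP] := trans.
pose cv (c : C) : V := (c%:M : 'rV[C]_1).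
have cv0 : cv 0 = 0 by apply: raddf0.
have cvK (v : V) : cv ((v : 'rV[C]_1) 0 0) = v.
  by apply/rowP => k; rewrite ord1 mxE eqxx.
have cvD c d : cv (c + d) = cv c + cv d by apply: raddfD.
pose coef (w : W) i := (w : 'rV[C]_n) 0 i / R (g_ i) i o.
pose psi (w : W) : Ind V := \sum_i tensor << g_ i >> (cv (coef w i)).
have tensor0r a : tensor a (0 : V) = 0.
  by apply: (addrI (tensor a (0 : V))); rewrite -tensorDr !addr0.
have tensor0l (v : V) : tensor 0 v = 0.
  by apply: (addrI (tensor 0 v)); rewrite -tensorDl !addr0.
have psiD u w : psi (u + w) = psi u + psi w.
  rewrite -big_split /=; apply: eq_bigr => i _.
  by rewrite -tensorDr -cvD /coef mxE mulrDl.
have psi_add : zmod_morphism psi.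
  by move=> u w; apply: (addIr (psi w)); rewrite -psiD !subrK.
pose psiA : {additive W -> Ind V} := HB.pack psi (GRing.isZmodMorphism.Build _
  _ psi psi_add).
have psi0 : psi 0 = 0 := raddf0 psiA.
have psiMz w k : psi (w *~ k) = psi w *~ k := raddfMz psiA k w.
(* phi maps g_ i (x) v to a multiple of the i-th basis vector *)
have phi_g i v : phi (tensor << g_ i >> v) =
    ((v : 'rV[C]_1) 0 0 * R (g_ i) i o) *: e i.
  rewrite phiT twalg_actU scale1r /= col_actE /embed -scalemxAl.
  by rewrite (act_e (gP i)) scalerA.
have psi_g i v : psi (phi (tensor << g_ i >> v)) = tensor << g_ i >> v.
  rewrite phi_g /psi (bigD1 i) //= big1 ?addr0 => [|j ne].
    by rewrite /coef !mxE !eqxx mulr1 mulfK ?gP // cvK.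
  rewrite (_ : coef _ _ = 0) ?cv0 ?tensor0r // /coef !mxE eqxx /=.
  by rewrite (negbTE ne) mulr0 mul0r.
have psi_T a v : psi (phi (tensor a v)) = tensor a v.
  elim/freeg_ind_add: a => [|a a' IHa IHa'|k x].
  - by rewrite tensor0l raddf0 psi0.
  - by rewrite tensorDl raddfD psiD IHa IHa'.
  have [j xj] := idx_ex x.
  have hH : ((g_ j)^-1 * x)%g \in [set` H].
    by rewrite inE /= unfold_in /line (entryM _ _ xj) !mulf_neq0 ?invr_neq0 //
      entryVE.
  pose h : subgroup H := exist (fun y => y \in [set` H]) _ hH.
  have -> : x = (g_ j * val h)%g by rewrite /= mulKVg.
  by rewrite tensorU psi_g.
exists psi.
  move=> y; rewrite -[y]generic_quotient.reprK;
    move: (generic_quotient.repr y) => {y}.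
  apply: freeg_ind_add => [|D D' IHD IHD'|k [a v]].
  - by rewrite !raddf0 psi0.
  - by rewrite !raddfD psiD IHD IHD'.
  rewrite -[k]intz -freegU_mulz.
  rewrite (raddfMz (\pi_(Quotient.quot (gen (tensor_rel (V := V)))))).
  suff : psi (phi (tensor a v *~ k)) = tensor a v *~ k by [].
  by rewrite raddfMz psiMz psi_T.
move=> w; rewrite raddf_sum [RHS](row_sum_delta (w : 'rV_n)) /=;
  apply: eq_bigr => i _.
by rewrite phi_g mxE eqxx mulr1n /coef divfK ?gP.
Qed.

(** H is the stabiliser of the line o, the set where a continuous function is
    nonzero, and its cosets correspond to the lines. *)
Lemma induced_from_line : induced_from_dim1 (matrix_fin_rep hC hmu rR fR).
Proof.
exists H, V; split; [exact: H_open | exact: H_index | | exact: is_Ind_line].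
by rewrite dimvf.
Qed.
End InducedLine.

Section MonomialClasses.
Variables (l : nat) (K : fieldType) (C : topClosedFieldType).
Variable iota : {rmorphism K -> C}.
Hypothesis hC : is_Ql_closure l iota.
Variables (G : topGroupType) (mu : G -> G -> C).
Hypothesis hmu : admissible_multiplier iota mu.

Section CoordinateSubspace.
Variables (n : nat) (A : {set 'I_n}).

Definition coord_mx : 'M[C]_(n, #|A|) := \matrix_(i, a) (i == enum_val a)%:R.

Lemma coord_mxE (M : 'M[C]_n) a b :
  (coord_mx^T *m M *m coord_mx) a b = M (enum_val a) (enum_val b).
Proof.
rewrite !mxE (bigD1 (enum_val b)) //= big1 ?addr0 => [|j /negbTE ne];
  last first.
  by rewrite !mxE ne mulr0.
rewrite !mxE eqxx mulr1 (bigD1 (enum_val a)) //= big1 ?addr0 => [|j /negbTE ne].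
  by rewrite !mxE eqxx mul1r.
by rewrite !mxE ne mul0r.
Qed.

Lemma coord_mxK : coord_mx^T *m coord_mx = 1%:M.
Proof.
apply/matrixP => a b; rewrite -[coord_mx^T]mulmx1 coord_mxE !mxE.
by rewrite (inj_eq enum_val_inj).
Qed.

Lemma coord_mx_proj :
  coord_mx *m coord_mx^T = \matrix_(i, j) ((i == j) && (i \in A))%:R.
Proof.
apply/matrixP => i j; rewrite !mxE; under eq_bigr do rewrite !mxE.
have [iA|niA] := boolP (i \in A); last first.
  rewrite andbF big1 // => a _; rewrite (_ : (i == _) = false) ?mul0r //.
  by apply: contraNF niA => /eqP ->; exact: enum_valP.
have [a ia] : exists a : 'I_#|A|, enum_val a = i.
  by exists (enum_rank_in iA i); exact: enum_rankK_in.
rewrite (bigD1 a) //= big1 ?addr0 => [|b ne].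
  by rewrite ia eqxx mul1r andbT [j == i]eq_sym.
by rewrite -ia (inj_eq enum_val_inj) eq_sym (negbTE ne) mul0r.
Qed.
End CoordinateSubspace.

Lemma coord_mx_orth n (A B : {set 'I_n}) : (A :&: B)%SET = finset.set0 ->
  (coord_mx B)^T *m coord_mx A = 0.
Proof.
move=> dAB; apply/matrixP => b a; rewrite !mxE big1 // => i _; rewrite !mxE.
have [->|ne] := eqVneq i (enum_val b); last by rewrite mul0r.
rewrite (_ : (enum_val b == _) = false) ?mulr0 //; apply/eqP => e.
have := finset.in_set0 (enum_val b).
by rewrite -dAB finset.in_setI enum_valP e enum_valP.
Qed.

(** The coordinate subspaces of A and of its complement are both invariant. *)
Lemma matrix_class_split n (R : G -> 'M[C]_n) rR fR (A : {set 'I_n}) :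
  (forall x i j, R x j i != 0 -> (i \in A) = (j \in A)) ->
  exists r1 f1 r2 f2,
    @matrix_class l K C iota hC G mu hmu n R rR fR =
    @matrix_class l K C iota hC G mu hmu #|A| (fun x =>
      (coord_mx A)^T *m R x *m coord_mx A) r1 f1 +
    @matrix_class l K C iota hC G mu hmu #|~: A| (fun x =>
      (coord_mx (~: A))^T *m R x *m coord_mx (~: A)) r2 f2.
Proof.
move=> clA.
have commA (B : {set 'I_n}) :
    (forall x i j, R x j i != 0 -> (i \in B) = (j \in B)) -> forall x,
    R x *m (coord_mx B *m (coord_mx B)^T) = coord_mx B *m (coord_mx B)^T *m R x.
  move=> clB x; rewrite coord_mx_proj; apply/matrixP => i j; rewrite !mxE.
  rewrite (bigD1 j) //= big1 ?addr0 => [|k /negbTE ne];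
    last by rewrite mxE ne mulr0.
  rewrite (bigD1 i) //= big1 ?addr0 => [|k]; last by rewrite eq_sym mxE =>
    /negbTE ->; rewrite mul0r.
  rewrite !mxE !eqxx /= mulrC; have [->|nz] := eqVneq (R x i j) 0;
    first by rewrite !mulr0.
  by rewrite (clB _ _ _ nz).
have clAc x i j : R x j i != 0 -> (i \in ~: A) = (j \in ~: A).
  by rewrite !inE => /clA ->.
have RT (B : {set 'I_n}) :
    (forall x i j, R x j i != 0 -> (i \in B) = (j \in B)) -> forall x,
    R x *m coord_mx B = coord_mx B *m ((coord_mx B)^T *m R x *m coord_mx B).
  by move=> clB x; rewrite !mulmxA -commA // -!mulmxA coord_mxK mulmx1.
exists (matrix_rep_summand hC hmu rR (coord_mxK A) (RT A clA)),
  (finite_mod_mulmx _ _ fR).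
exists (matrix_rep_summand hC hmu rR (coord_mxK (~: A)) (RT _ clAc)),
  (finite_mod_mulmx _ _ fR).
apply: (@matrix_class_biproduct _ _ _ _ hC _ _ hmu _ _ _ _ _ _ _ _ _ _ _ _
  (coord_mx A) (coord_mx A)^T (coord_mx (~: A)) (coord_mx (~: A))^T).
- exact: coord_mxK.
- exact: coord_mxK.
- by apply: coord_mx_orth; exact: finset.setICr.
- rewrite !coord_mx_proj; apply/matrixP => i j; rewrite !mxE !inE.
  by case: (i == j); case: (i \in A); rewrite /= ?addr0 ?add0r.
- exact: RT.
by move=> x; rewrite -[RHS]mulmxA -[RHS]mulmxA (commA _ clAc) !mulmxA coord_mxK
  mul1mx.
Qed.

Definition induced_classes : set (K0fin iota mu) :=
  [set K0class W | W in [set W : fin_rep iota mu | induced_from_dim1 W]].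

(** Split off the orbit of a line, and use induction for the others. *)
Lemma monomial_class n (R : G -> 'M[C]_n) rR fR :
  (forall x i j j', R x j i != 0 -> R x j' i != 0 -> j = j') ->
  @matrix_class l K C iota hC G mu hmu n R rR fR \in gen induced_classes.
Proof.
have [m] := ubnP n; elim: m n R rR fR => // m IHm [|n] R rR fR ltn mono.
  by rewrite matrix_class0 rpred0.
pose A := line_orbit R 0.
have [r1 [f1 [r2 [f2 ->]]]] := matrix_class_split rR fR (line_orbit_closed hmu
  rR 0 mono).
rewrite -/A in r1 f1 r2 f2 *.
have oA : 0 \in A := mem_line_orbit hmu rR 0.
have ltAc : (#|~: A| < m)%N.
  have A_gt0 : (0 < #|A|)%N by apply/card_gt0P; exists 0.
  by have := cardsC A; rewrite card_ord; lia.
have subm B x a b c : ((coord_mx B)^T *m R x *m coord_mx B) b a != 0 ->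
   ((coord_mx B)^T *m R x *m coord_mx B) c a != 0 -> b = c.
  by rewrite !coord_mxE => ba ca; apply/enum_val_inj/(mono _ _ _ _ ba ca).
apply: rpredD; last by apply: IHm => // x i j j'; exact: subm.
apply: gen_sub.
exists (matrix_fin_rep hC hmu r1 f1) => //=.
apply: (induced_from_line hC hmu r1 f1 (o := enum_rank_in oA 0)) =>
  [x i j j'|i].
  exact: subm.
have := enum_valP i; rewrite finset.in_set => /asboolP[x xi]; exists x.
by rewrite coord_mxE enum_rankK_in.
Qed.
End MonomialClasses.

Arguments induced_classes [K C] iota [G] mu _.

(** * The finite projective image *)

Section ProjectiveImage.
Variables (l : nat) (K : fieldType) (C : topClosedFieldType).
Variable iota : {rmorphism K -> C}.
Hypothesis hC : is_Ql_closure l iota.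
Variables (G : topGroupType) (mu : G -> G -> C).
Hypothesis hmu : admissible_multiplier iota mu.
Variables (n : nat) (R : G -> 'M[C]_n) (rR : matrix_rep iota mu R).
Hypothesis fR : finite_mod_scalars R.

Definition proportional x y := exists2 c, c != 0 & R x = c *: R y.

Lemma proportional_refl x : proportional x x.
Proof. by exists 1; rewrite ?oner_neq0 ?scale1r. Qed.

Lemma proportional_sym x y : proportional x y -> proportional y x.
Proof.
by move=> [c nzc e]; exists c^-1; rewrite ?invr_neq0 // e scalerA mulVf //
  scale1r.
Qed.

Lemma proportional_trans x y z : proportional x y -> proportional y z ->
  proportional x z.
Proof.
by move=> [c nzc e] [d nzd f]; exists (c * d);
  rewrite ?mulf_neq0 // e f scalerA.
Qed.

Let muN0 x y : mu x y != 0. Proof. by case: hmu. Qed.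

Let RMM x y : R (x * y)%g = (mu x y)^-1 *: (R x *m R y).
Proof. by rewrite (matrix_repM rR) scalerA mulVf ?scale1r. Qed.

Lemma proportionalM x x' y y' :
  proportional x x' -> proportional y y' -> proportional (x * y)%g (x' * y')%g.
Proof.
move=> [c nzc e] [d nzd f]; exists ((mu x y)^-1 * (c * (d * mu x' y'))).
  by rewrite !mulf_neq0 ?invr_neq0.
by rewrite !RMM e f -scalemxAl -scalemxAr !scalerA -!mulrA mulfV // mulr1.
Qed.

Lemma proportionalMr x x' y : proportional (x * y)%g (x' * y)%g ->
  proportional x x'.
Proof.
by move/proportionalM/(_ (proportional_refl y^-1%g)); rewrite !mulgK.
Qed.

(** The given F only separates the classes; the first f in F whose chosen
    representative t f is proportional to x is a canonical choice. *)
Lemma projective_classes : exists (J : finType) (cls : G -> J) (s : J -> G),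
  cancel s cls /\ forall x y, cls x = cls y <-> proportional x y.
Proof.
have [F [p0 p0P]] := fR.
have /fin_all_exists[t tP] (f : F) : exists t : G,
  (exists y, p0 y = f) -> p0 t = f.
  by case: (pselect (exists y, p0 y = f)) => [[y e]|ne];
    [exists y | exists 1%g].
(* this only depends on the class of x *)
pose idx x := [pick f | `[< proportional (t f) x >]].
have idx_ex x : exists2 f, idx x = Some f & proportional (t f) x.
  rewrite /idx; case: pickP => [f /asboolP pf|/(_ (p0 x))/asboolP[]];
    first by exists f.
  by apply: p0P; apply: tP; exists x.
have idxE x y : proportional x y -> idx x = idx y.
  move=> xy; apply: eq_pick => f; apply/asboolP/asboolP => h.
    exact: proportional_trans h xy.
  exact: proportional_trans h (proportional_sym xy).
pose J := {f : F | idx (t f) == Some f}.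
have /choice[cls clsP] x : exists j : J, proportional (t (val j)) x.
  have [f ef pf] := idx_ex x;
    have fJ : idx (t f) == Some f by rewrite (idxE _ _ pf) ef.
  by exists (exist _ f fJ).
have clsE x y : cls x = cls y <-> proportional x y.
  split=> [e|xy].
    apply: proportional_trans (clsP y); rewrite -e; exact/proportional_sym/clsP.
  apply: val_inj; have /eqP := valP (cls x); have /eqP := valP (cls y).
  have -> : idx (t (val (cls y))) = idx (t (val (cls x))).
    apply: idxE; apply: proportional_trans (clsP y) _.
    apply: proportional_trans (proportional_sym xy) _;
      exact/proportional_sym/clsP.
  by move=> -> [].
exists J, cls, (fun j => t (val j)); split=> // j.
apply: val_inj; have /eqP := valP j; have /eqP := valP (cls (t (val j))).
by rewrite (idxE _ _ (clsP (t (val j)))) => -> [].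
Qed.

(** The group of permutations of the proportionality classes induced by right
    multiplications: it is finite, and x acts trivially only if it is
    proportional to 1. *)
Lemma projective_image : exists (gT : finGroupType) (p : G -> gT) (s : gT -> G),
  [/\ forall x y, p (x * y)%g = (p x * p y)%g, cancel s p
    & forall x y, p x = p y <-> proportional x y].
Proof.
have [J [cls [s [sK clsE]]]] := projective_classes.
have scls x : proportional (s (cls x)) x by apply/clsE; rewrite sK.
pose sig x (j : J) := cls (s j * x)%g.
have sig_inj x : injective (sig x).
  by move=> j k /clsE/proportionalMr/clsE; rewrite !sK.
pose sigp x : {perm J} := perm (sig_inj x).
have sigM x y : sigp (x * y)%g = (sigp x * sigp y)%g.
  apply/permP => j; rewrite permM !permE; apply/clsE; rewrite mulgA.
  exact: proportionalM (proportional_sym (scls _)) (proportional_refl _).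
have sigE x y : sigp x = sigp y <-> proportional x y.
  split=> [e|xy].
    have := congr1 (fun f : {perm J} => f (cls 1%g)) e; rewrite !permE =>
      /clsE h.
    have h1 z : proportional z (s (cls 1%g) * z)%g.
      by rewrite -{1}[z]mul1g; apply: proportionalM (proportional_sym (scls _))
        (proportional_refl _).
    exact: proportional_trans (h1 x)
      (proportional_trans h (proportional_sym (h1 y))).
  by apply/permP => j; rewrite !permE; apply/clsE; apply: proportionalM => //;
    exact: proportional_refl.
have sig1 : sigp 1%g = 1%g by apply: (mulgI (sigp 1%g)); rewrite -sigM !mulg1.
pose Q : {set {perm J}} := [set q | `[< exists x, sigp x = q >]]%SET.
have Qgroup : group_set Q.
  apply/group_setP; split; first by rewrite finset.in_set; apply/asboolP;
    exists 1%g.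
  move=> q r; rewrite !finset.in_set => /asboolP[x <-] /asboolP[y <-];
    apply/asboolP.
  by exists (x * y)%g.
pose QG := Group Qgroup.
have sQ x : sigp x \in QG by rewrite finset.in_set; apply/asboolP; exists x.
pose p x : subg_of QG := Subg (sQ x).
have /choice[s' s'P] (q : subg_of QG) : exists x, p x = q.
  have := valP q; rewrite finset.in_set => /asboolP[x e]; exists x.
  exact: val_inj.
exists (subg_of QG), p, s'; split=> // [x y|x y].
  by apply: val_inj; rewrite /= sigM.
split=> [/(congr1 val)/sigE //|xy].
by apply: val_inj; apply/sigE.
Qed.

(** R x and R y are proportional if and only if the products of entries
    (R x) i j * (R y) k q and (R x) k q * (R y) i j always agree. So the fibres
    of p are closed, and they are finitely many. *)
Lemma proportional_open (gT : finGroupType) (p : G -> gT) :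
  (forall g, exists x, p x = g) ->
  (forall x y, p x = p y <-> proportional x y) ->
  forall g, open [set x | p x = g].
Proof.
move=> p_surj pE.
have nopen g : open [set x | p x != g].
  have [y <-] := p_surj g.
  pose f (q : 'I_n * 'I_n * ('I_n * 'I_n)) x :=
    R x q.1.1 q.1.2 * R y q.2.1 q.2.2
     + - (R x q.2.1 q.2.2 * R y q.1.1 q.1.2).
  have f_cts q : continuous (f q).
    suff [] : admissible iota (f q) by [].
    apply: (admissibleD hC).
      by apply: (admissibleM hC); [exact: (matrix_rep_adm rR) | exact:
        (admissible_cst hC)].
    under eq_fun do rewrite -mulrN.
    by apply: (admissibleM hC); [exact: (matrix_rep_adm rR) | exact:
      (admissible_cst hC)].
  have -> : [set x | p x != p y] = \bigcup_q (f q @^-1` [set c | c != 0]).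
    apply/seteqP; split=> x /=; last first.
      move=> [q _ /=]; apply: contra_neq => /pE[c _ e].
      by rewrite /f e !mxE mulrAC subrr.
    move=> ne; apply: contrapT => none; move/eqP: ne; apply; apply/pE.
    have f0 q : f q x = 0 by apply: contrapT => /eqP h; apply: none; exists q.
    have [n0|n_gt0] := posnP n.
      exists 1; rewrite ?oner_neq0 //; apply/matrixP => i.
      by have : (i < 0)%N by rewrite -[X in (_ < X)%N]n0 ltn_ord.
    have [[a b] /= nz] : exists ab : 'I_n * 'I_n, R y ab.1 ab.2 != 0.
      apply/existsP; rewrite -[X in is_true X]negbK negb_exists; apply/negP =>
        /forallP z.
      have y0 : R y = 0 by apply/matrixP => i j; have := z (i, j);
        rewrite negbK mxE => /eqP.
      have := matrix_rep_unit rR y; rewrite y0 -row_free_unit /row_free mxrank0.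
      by rewrite eq_sym gtn_eqF.
    exists (R x a b / R y a b); last first.
      apply/matrixP => i j; have := f0 ((i, j), (a, b)); rewrite /f /= => /eqP.
      rewrite subr_eq0 => /eqP e; rewrite mxE mulrAC -e mulfK //.
    apply/negP => /eqP c0; have x0 : R x = 0.
      apply/matrixP => i j; have := f0 ((i, j), (a, b)); rewrite /f /= => /eqP.
      rewrite subr_eq0 => /eqP e; rewrite mxE; apply: (mulIf nz);
        rewrite e mul0r.
      by move/eqP: c0; rewrite mulf_eq0 invr_eq0 (negbTE nz) orbF => /eqP ->;
        rewrite mul0r.
    have := matrix_rep_unit rR x; rewrite x0 -row_free_unit /row_free mxrank0.
    by rewrite eq_sym gtn_eqF.
  apply: bigcup_open => q _; apply: open_comp; first by move=> x _;
    exact: f_cts.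
  by have [vK [v [_ _ vv _ nv]]] := hC; exact: neq0_open vv nv.
move=> g; have -> : [set x | p x = g] = [set x | p x \notin enum (predC1 g)].
  by apply/seteqP; split=> x /=; rewrite mem_enum inE negbK => /eqP.
elim: (enum _) => [|h r IHr].
  by rewrite (_ : [set x | _] = setT); [exact: openT | apply/seteqP; split].
have -> : [set x | p x \notin h :: r] = [set x | p x != h] `&` [set x | p x
  \notin r].
  by apply/seteqP; split=> x /=; rewrite inE negb_or => /andP.
exact: openI.
Qed.
End ProjectiveImage.

(** * Induction from the projective image *)

Section Assembly.
Variables (l : nat) (K : fieldType) (C : topClosedFieldType).
Variable iota : {rmorphism K -> C}.
Hypothesis hC : is_Ql_closure l iota.
Variables (G : topGroupType) (mu : G -> G -> C).
Hypothesis hmu : admissible_multiplier iota mu.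

(** Conjugating by B gives matrices with at most one nonzero entry in each row.
    As the inverses have the same form, the same holds for the columns. *)
Lemma matrix_class_monomial_basis n (R : G -> 'M[C]_n)
    (rR : matrix_rep iota mu R) (fR : finite_mod_scalars R) (B : 'M[C]_n) :
  B \in unitmx -> (forall x i, exists j d, row i (B *m R x) = d *: row j B) ->
  matrix_class hC hmu rR fR \in gen (induced_classes iota mu).
Proof.
move=> Bunit BR.
have BV : B *m invmx B = 1%:M by exact: mulmxV.
have VB : invmx B *m B = 1%:M by exact: mulVmx.
have RT x : R x *m invmx B = invmx B *m (B *m R x *m invmx B).
  by rewrite !mulmxA VB mul1mx.
pose rP := matrix_rep_summand hC hmu rR BV RT.
pose fP := finite_mod_mulmx (invmx B) B fR.
rewrite (matrix_class_iso hC hmu rR fR rP fP BV VB RT).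
set P := fun x => B *m R x *m invmx B in rP fP *.
have Prow x i j j' : P x i j != 0 -> P x i j' != 0 -> j = j'.
  have [k [d e]] := BR x i.
  have Pik q : P x i q = d * (k == q)%:R.
    have -> : P x i q = (row i (B *m R x) *m invmx B) 0 q
      by rewrite -row_mul [RHS]mxE.
    by rewrite e -scalemxAl -row_mul BV !mxE.
  rewrite !Pik; case: (eqVneq k j) => [<-|_]; last by rewrite mulr0 eqxx.
  by case: (eqVneq k j') => // _; rewrite mulr0 eqxx.
move: P rP fP Prow => P rP fP Prow.
apply: monomial_class => x i j j'.
(* only one term of the k-th row of P x contributes to the diagonal entry of
   P x *m P x^-1 *)
have PV k : P x k i != 0 -> P x^-1%g i k != 0.
  move=> nz; have := congr1 (fun M : 'M_n => M k k) (matrix_repM rP x x^-1%g).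
  rewrite mulgV (matrix_rep1 hmu rP) !mxE eqxx mulr1 (bigD1 i) //= big1 ?addr0
    => [h|q ne].
    have mu0 : mu x x^-1%g != 0 by case: hmu.
    by apply: contra_neq mu0 => z; rewrite -h z mulr0.
  suff -> : P x k q = 0 by rewrite mul0r.
  by apply/eqP; apply: contraNT ne => nz'; apply/eqP/(Prow x k).
by move=> /PV ij /PV ij'; exact: Prow ij ij'.
Qed.

Lemma matrix_class_cast n n' (e : n = n')
    (R : G -> 'M[C]_n) (R' : G -> 'M[C]_n') rR fR rR' fR' :
  (forall x, R' x = castmx (e, e) (R x)) ->
  @matrix_class l K C iota hC G mu hmu n R rR fR =
    @matrix_class l K C iota hC G mu hmu n' R' rR' fR'.
Proof.
case: n' / e R' rR' fR' => R' rR' fR' RR'.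
apply: (matrix_class_iso hC hmu rR fR rR' fR' (T := 1%:M) (S := 1%:M));
  rewrite ?mulmx1 //.
by move=> x; rewrite mul1mx mulmx1 RR' castmx_id.
Qed.

Lemma row_free_bij (F : fieldType) n1 n2 (B : 'M[F]_(n1, n2)) : n1 = n2 ->
  row_free B ->
  exists2 B' : 'M_(n2, n1), B *m B' = 1%:M & B' *m B = 1%:M.
Proof.
move=> e; case: n2 / e B => B; rewrite row_free_unit => uB.
by exists (invmx B); rewrite ?mulmxV ?mulVmx.
Qed.

(** Tensor the isomorphism of permutation representations given by
    [monomial_induction] with the identity of R. *)
Lemma matrix_class_gen n (R : G -> 'M[C]_n)
    (rR : matrix_rep iota mu R) (fR : finite_mod_scalars R) :
  matrix_class hC hmu rR fR \in gen (induced_classes iota mu).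
Proof.
have [gT [p [s [pM sK pE]]]] := projective_image hmu rR fR.
have p_surj g : exists x, p x = g by exists (s g).
have p_open := proportional_open hC rR p_surj pE.
(* the projective representation of the finite group; c0 is its cocycle *)
pose M g := R (s g).
have muN0 x y : mu x y != 0 by case: hmu.
have Rs x : proportional R x (s (p x)) by apply/pE; rewrite sK.
have /choice[c0 c0P] (gh : gT * gT) : exists c, c != 0 /\ M gh.1 *m M gh.2 =
  c *: M (gh.1 * gh.2)%g.
  have [d nzd e] := Rs (s gh.1 * s gh.2)%g; exists (mu (s gh.1) (s gh.2) * d).
  by rewrite mulf_neq0 // /M (matrix_repM rR) e scalerA pM !sK.
have [X [Y [toX [toY [[BX BXu BXM] [BY BYu BYM] simXY]]]]] :=
  @monomial_induction C gT n M (fun g h => c0 (g, h)) (pchar_closure hC)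
    (fun g h => (c0P (g, h)).1) (fun g h => (c0P (g, h)).2) (fun g =>
      matrix_rep_unit rR (s g)).
have prop_p x y : p x = p y -> exists2 c, c != 0 & R x = c *: R y by move/pE.
have memZ (Z : finType) (to : {action gT &-> Z}) (B : 'M[C]_(#|Z| * n))
    (Bu : B \in unitmx)
    (BM : forall g i, exists j d,
      row i (B *m (perm_act_mx C to g *t M g)) = d *: row j B) :
    matrix_class hC hmu
      (matrix_rep_tens hC hmu pM p_open (perm_act_repr C to) rR)
      (finite_mod_tens (perm_act_repr C to) prop_p)
    \in gen (induced_classes iota mu).
  apply: (matrix_class_monomial_basis _ _ Bu) => x i.
  have [j [d e]] := BM (p x) i; have [c nzc ex] := Rs x; exists j, (c * d).
  rewrite -scalerA -e -linearZ /= scalemxAr; congr (row i (B *m _)).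
  by rewrite ex; apply/matrixP => a b; rewrite !mxE mulrCA.
have memX := memZ X toX BX BXu BXM; have memY := memZ Y toY BY BYu BYM.
pose T1 := MxRepresentation (triv_mx_repr C gT).
have [B eXY freeB homB] := simXY.
have [B' BB' B'B] := row_free_bij eXY freeB.
(* R and 1 (x) R only differ by the equation 1 * n = n *)
have cast1 : matrix_class hC hmu rR fR =
    matrix_class hC hmu (matrix_rep_tens hC hmu pM p_open T1 rR)
      (finite_mod_tens T1 prop_p).
  apply: (matrix_class_cast (e := esym (mul1n n))) => x.
  by rewrite -tens_scalar1mx.
rewrite cast1.
suff e : matrix_class hC hmu
      (matrix_rep_tens hC hmu pM p_open (perm_act_repr C toX) rR)
      (finite_mod_tens (perm_act_repr C toX) prop_p) =
    matrix_class hC hmu (matrix_rep_tens hC hmu pM p_open T1 rR)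
      (finite_mod_tens T1 prop_p) +
    matrix_class hC hmu
      (matrix_rep_tens hC hmu pM p_open (perm_act_repr C toY) rR)
      (finite_mod_tens (perm_act_repr C toY) prop_p).
  by rewrite -[X in X \in _](addrK (matrix_class hC hmu
      (matrix_rep_tens hC hmu pM p_open (perm_act_repr C toY) rR)
      (finite_mod_tens (perm_act_repr C toY) prop_p))) -e rpredB.
pose BL : 'M[C]_(#|X|, 1) := lsubmx B; pose BR : 'M[C]_(#|X|, #|Y|) := rsubmx B.
pose BU : 'M[C]_(1, #|X|) := usubmx B'; pose BD : 'M[C]_(#|Y|, #|X|) :=
  dsubmx B'.
have defB : B = row_mx BL BR by rewrite hsubmxK.
have defB' : B' = col_mx BU BD by rewrite vsubmxK.
have := B'B; rewrite defB defB' mul_col_row scalar_mx_block =>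
  /eq_block_mx[UL _ DL DR].
have sumB : BL *m BU + BR *m BD = 1%:M by rewrite -mul_row_col -defB -defB' BB'.
have homL g : perm_act_mx C toX g *m BL = BL *m 1%:M.
  have := homB g (finset.in_setT g); rewrite defB mul_mx_row mul_row_block
    !mulmx0 addr0 add0r.
  by move/eq_row_mx => [].
have homD g : BD *m perm_act_mx C toX g = perm_act_mx C toY g *m BD.
  have := congr1 (mulmx B' \o mulmx^~ B') (homB g (finset.in_setT g)).
  rewrite /= -!mulmxA BB' mulmx1 !mulmxA B'B mul1mx defB' mul_col_mx
    mul_block_col.
  by rewrite !mul0mx add0r addr0 => /eq_col_mx[].
apply: (@matrix_class_biproduct _ _ _ _ hC _ _ hmu _ _ _ _ _ _ _ _ _ _ _ _
  (BL *t 1%:M) (BU *t 1%:M) (BR *t 1%:M) (BD *t 1%:M)).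
- by rewrite tensmx_mul UL mulmx1 tensmx11.
- by rewrite tensmx_mul DR mulmx1 tensmx11.
- by rewrite tensmx_mul DL tens0mx.
- rewrite !tensmx_mul mulmx1 -tensmx11 -sumB.
  by apply/matrixP => i j; rewrite !mxE mulrDl.
- by move=> x; rewrite !tensmx_mul mulmx1 mul1mx /= homL.
by move=> x; rewrite !tensmx_mul mulmx1 mul1mx /= homD.
Qed.
End Assembly.

Theorem theorem2p36 (l : nat) (hl : prime l)
  (Ql : fieldType) (C : topClosedFieldType) (iota : {rmorphism Ql -> C})
  (hC : is_Ql_closure l iota)
  (G : topGroupType) (mu : G -> G -> C)
  (hmu : admissible_multiplier iota mu) :
  forall x : K0fin iota mu,
    x \in gen [set K0class W | W in
                [set W : fin_rep iota mu | induced_from_dim1 W]].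
Proof.
move=> x; rewrite -[x]generic_quotient.reprK;
  move: (generic_quotient.repr x) => {x}.
apply: freeg_ind_add => [|D D' IHD IHD'|k V].
- by rewrite raddf0 rpred0.
- by rewrite raddfD rpredD.
rewrite -[k]intz -freegU_mulz raddfMz rpredMz //.
suff : K0class V \in gen (induced_classes iota mu) by [].
by rewrite (K0class_rep_matrix hC hmu); exact: matrix_class_gen.
Qed.
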